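(* Let $0 < \kappa < 1$ and $\lambda = \sqrt{1 - \kappa^2}$. Let $w$ be a solution, holomorphic near $0$, of the differential equation $(w')^2 = T_6(w) - (1 - 2\kappa^2)$ with $w(0) = 0$, and put $W = 2w^2 - 1$. Then $W$ (extends to) the elliptic function determined by $$(1 + W)(6 - P) = 4 \lambda^2,$$ where $P = \wp(\,\cdot\,; G_2, G_3)$ is the Weierstrass function with invariants $G_2 = 48(1 + 8\kappa^2)$ and $G_3 = 64(1 - 20\kappa^2 - 8\kappa^4)$.
   Context: $T_6$ is the degree six Chebyshev polynomial of the first kind, $T_6(\cos t) = \cos 6t$. $\wp(\,\cdot\,; g_2, g_3)$ denotes the Weierstrass elliptic function with invariants $g_2, g_3$, i.e. the solution of $(\wp')^2 = 4\wp^3 - g_2 \wp - g_3$ with a double pole at $0$ (principal part $z^{-2}$). *)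

(* Defs.v *)
From Stdlib Require Import Reals.
From Coquelicot Require Import Coquelicot.
Open Scope C_scope.

Fixpoint cheb_pair (n : nat) (x : C) : C * C :=
  match n with
  | O => (RtoC 1, x)
  | S m => let p := cheb_pair m x in (snd p, RtoC 2 * x * snd p - fst p)
  end.
Definition chebT (n : nat) (x : C) : C := fst (cheb_pair n x).
Definition T6 (x : C) : C := chebT 6 x.

Definition Cderiv (f : C -> C) (z l : C) : Prop :=
  @is_derive C_AbsRing C_NormedModule f z l.

(* P is a Weierstrass function with invariants g2, g3 on the punctured disc
   0 < |z| < rho: holomorphic there with derivative dP, satisfying
   (P')^2 = 4 P^3 - g2 P - g3, and with a double pole at 0 of principal
   part z^{-2} (P z - 1/z^2 extends holomorphically to the full disc). *)
Definition weierstrass_local (g2 g3 : C) (rho : R) (P dP : C -> C) : Prop :=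
  (forall z, 0 < Cmod z < rho ->
     Cderiv P z (dP z) /\
     dP z * dP z = RtoC 4 * P z * P z * P z - g2 * P z - g3) /\
  exists h dh : C -> C,
    (forall z, Cmod z < rho -> Cderiv h z (dh z)) /\
    (forall z, 0 < Cmod z < rho -> P z = / (z * z) + h z).

(* Main.v *)
Require Import Defs.
From Stdlib Require Import Reals Psatz ClassicalEpsilon.
From Coquelicot Require Import Coquelicot.

(** Put [A = lambda^2]. Both [w^2] and [2 A / (6 - P)] solve
    [(U')^2 = 4 U (32 U^3 - 48 U^2 + 18 U - 2 A)] and are asymptotic to [-2 A z^2] at [0].
    Factoring the difference of the two equations gives a singular linear equation
    [D' ~ D / z] for the difference [D = o(z^2)], which forces [D = 0] near [0]. The
    identity theorem extends [w^2 z^2 (6 - P) = 2 A z^2] from there to the whole disc.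

    Derivatives are only assumed to exist pointwise, so Cauchy's formula has to come from
    Goursat's theorem; it yields both the identity theorem and the asymptotics
    [U' ~ -4 A z]. *)

Open Scope R_scope.
Open Scope C_scope.

Notation nhds z := (@locally (AbsRing_UniformSpace C_AbsRing) (z : C)).
Notation nhds' z := (@locally' (AbsRing_UniformSpace C_AbsRing) (z : C)).

(** * Limits and derivatives of complex functions *)

Lemma RtoC_neq (x y : R) : x <> y -> RtoC x <> RtoC y.
Proof. intros Hxy E. now apply Hxy, RtoC_inj. Qed.

Lemma Cmod_minus_sym (x y : C) : Cmod (x - y) = Cmod (y - x).
Proof. rewrite <- Cmod_opp. f_equal. ring. Qed.

Lemma Cmod_minus_le (x y : C) : (Cmod (x - y) <= Cmod x + Cmod y)%R.
Proof. rewrite <- (Cmod_opp y). apply Cmod_triangle. Qed.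

Lemma Cmod_le_minus (x y : C) : (Cmod x <= Cmod (x - y) + Cmod y)%R.
Proof. replace x with (x - y + y) at 1 by ring. apply Cmod_triangle. Qed.

Lemma Cmod_minus_trans (x y z : C) : (Cmod (x - z) <= Cmod (x - y) + Cmod (y - z))%R.
Proof. replace (x - z) with (x - y + (y - z)) by ring. apply Cmod_triangle. Qed.

Lemma Cmod_div_le (x z : C) (a M : R) :
  (0 < a <= Cmod z)%R -> (Cmod x <= M)%R -> (Cmod (x / z) <= M / a)%R.
Proof.
  intros Hz Hx. rewrite Cmod_div by (apply Cmod_gt_0; lra).
  apply Rmult_le_compat; [apply Cmod_ge_0 | | exact Hx | apply Rinv_le_contravar; lra].
  left. apply Rinv_0_lt_compat. lra.
Qed.

Lemma nhds_iff (z : C) (P : C -> Prop) :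
  nhds z P <-> exists delta : R, (0 < delta)%R /\ forall y, Cmod (y - z) < delta -> P y.
Proof.
  split.
  - intros [d Hd]. exists d. split; [apply cond_pos | exact Hd].
  - intros [d [Hd H]]. exists (mkposreal d Hd). exact H.
Qed.

Lemma nhds_singleton (z : C) (P : C -> Prop) : nhds z P -> P z.
Proof. exact (locally_singleton (T := AbsRing_UniformSpace C_AbsRing) z P). Qed.

Lemma nhds'_0_iff (P : C -> Prop) :
  nhds' 0 P <-> exists delta : R, (0 < delta)%R /\ forall z, 0 < Cmod z < delta -> P z.
Proof.
  unfold locally', within. rewrite nhds_iff.
  split; intros [d [Hd H]]; exists d; split; auto; intros z Hz.
  - apply H; [replace (z - 0) with z by ring; lra | apply Cmod_gt_0; lra].
  - intros Hz0. apply H. replace (z - 0) with z in Hz by ring.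
    split; [now apply Cmod_gt_0 | exact Hz].
Qed.

Lemma nhds_of_punctured (z : C) (P : C -> Prop) : P z -> nhds' z P -> nhds z P.
Proof.
  intros Hz. unfold locally', within. apply filter_imp. intros y Hy.
  destruct (Ceq_dec y z) as [->|Hyz]; [exact Hz | now apply Hy].
Qed.

Lemma nhds'_neq (z : C) : nhds' z (fun y : C => y <> z).
Proof. unfold locally', within. now apply filter_forall. Qed.

Lemma filterlim_nhds {T : Type} (F : (T -> Prop) -> Prop) {FF : Filter F}
  (f : T -> C) (l : C) :
  filterlim f F (nhds l) <->
  forall eps : R, (0 < eps)%R -> F (fun x => Cmod (f x - l) < eps).
Proof.
  rewrite (filterlim_locally (U := AbsRing_UniformSpace C_AbsRing) f l). split.
  - intros H eps He. exact (H (mkposreal eps He)).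
  - intros H eps. exact (H eps (cond_pos eps)).
Qed.

Section FilterLimits.

Context {T : Type} {F : (T -> Prop) -> Prop} {FF : Filter F}.

Lemma Clim_eq (f : T -> C) (a b : C) :
  filterlim f F (nhds a) -> a = b -> filterlim f F (nhds b).
Proof. now intros H <-. Qed.

Lemma Clim_const (a : C) : filterlim (fun _ : T => a) F (nhds a).
Proof. exact (filterlim_const (U := AbsRing_UniformSpace C_AbsRing) a). Qed.

Lemma Clim_plus (f g : T -> C) (a b : C) :
  filterlim f F (nhds a) -> filterlim g F (nhds b) ->
  filterlim (fun x => f x + g x) F (nhds (a + b)).
Proof.
  intros Hf Hg. apply (filterlim_comp_2 f g Cplus Hf Hg).
  exact (filterlim_plus (V := AbsRing_NormedModule C_AbsRing) a b).
Qed.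

Lemma Clim_mult (f g : T -> C) (a b : C) :
  filterlim f F (nhds a) -> filterlim g F (nhds b) ->
  filterlim (fun x => f x * g x) F (nhds (a * b)).
Proof.
  intros Hf Hg. apply (filterlim_comp_2 f g Cmult Hf Hg).
  exact (filterlim_mult (K := C_AbsRing) a b).
Qed.

Lemma Clim_minus (f g : T -> C) (a b : C) :
  filterlim f F (nhds a) -> filterlim g F (nhds b) ->
  filterlim (fun x => f x - g x) F (nhds (a - b)).
Proof.
  intros Hf Hg. apply Clim_plus; [exact Hf|].
  apply (filterlim_comp _ _ _ g Copp F (nhds b)); [exact Hg|].
  exact (filterlim_opp (V := AbsRing_NormedModule C_AbsRing) b).
Qed.

Lemma Clim_inv (f : T -> C) (a : C) : a <> 0 ->
  filterlim f F (nhds a) -> filterlim (fun x => / f x) F (nhds (/ a)).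
Proof.
  intros Ha Hf. apply Cmod_gt_0 in Ha as Ha'.
  apply filterlim_nhds; [exact FF|]. intros eps He.
  rewrite filterlim_nhds in Hf by exact FF.
  assert (Haa : (0 < Cmod a * Cmod a)%R) by nra.
  assert (Hhalf := Hf (Cmod a / 2)%R ltac:(lra)).
  assert (Hclose := Hf (eps * (Cmod a * Cmod a) / 2)%R ltac:(nra)).
  generalize (filter_and _ _ Hhalf Hclose). apply filter_imp. clear Hhalf Hclose.
  intros x [Hhalf Hclose].
  assert (Hfa : (Cmod a / 2 < Cmod (f x))%R).
  { assert (Htri := Cmod_le_minus a (f x)). rewrite Cmod_minus_sym in Htri. lra. }
  assert (Hf0 : f x <> 0) by (apply Cmod_gt_0; lra).
  replace (/ f x - / a) with (- (f x - a) / (f x * a)) by (field; auto).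
  rewrite Cmod_div, Cmod_opp, Cmod_mult by now apply Cmult_neq_0.
  apply Rlt_div_l; [nra|].
  assert (eps * (Cmod a / 2 * Cmod a) < eps * (Cmod (f x) * Cmod a))%R
    by (apply Rmult_lt_compat_l; nra).
  lra.
Qed.

End FilterLimits.

Lemma Clim_id (z : C) : filterlim (fun y => y) (nhds' z) (nhds z).
Proof. intros P HP. apply filter_le_within. exact HP. Qed.

Definition Cderivable (f : C -> C) (z : C) : Prop := exists l, Cderiv f z l.

(* [C_NormedModule] carries the product topology and [AbsRing_NormedModule C_AbsRing] that of
   the modulus; the library's product and chain rules are stated for the latter. *)
Lemma Cderiv_AbsRing (f : C -> C) (z l : C) :
  Cderiv f z l <->
  is_derive (K := C_AbsRing) (V := AbsRing_NormedModule C_AbsRing) f z l.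
Proof. split; intros [_ H]; (split; [apply is_linear_scal_l | exact H]). Qed.

Lemma Cderiv_iff (f : C -> C) (z l : C) :
  Cderiv f z l <->
  forall eps : R, (0 < eps)%R ->
    nhds z (fun y => Cmod (f y - f z - l * (y - z)) <= eps * Cmod (y - z))%R.
Proof.
  rewrite Cderiv_AbsRing. split.
  - intros [_ H] eps He.
    generalize (H z (fun P HP => HP) (mkposreal eps He)). apply filter_imp. intros y Hy.
    replace (f y - f z - l * (y - z)) with (f y - f z - (y - z) * l) by ring. exact Hy.
  - intros H. split; [apply is_linear_scal_l|]. intros x Hx eps.
    apply (is_filter_lim_locally_unique (V := AbsRing_NormedModule C_AbsRing)) in Hx as <-.
    generalize (H eps (cond_pos eps)). apply filter_imp. intros y Hy.
    replace (f y - f z - l * (y - z)) with (f y - f z - (y - z) * l) in Hy by ring. exact Hy.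
Qed.

Lemma Cderiv_iff_lim (f : C -> C) (z l : C) :
  Cderiv f z l <-> filterlim (fun y => (f y - f z) / (y - z)) (nhds' z) (nhds l).
Proof.
  rewrite Cderiv_iff, filterlim_nhds by typeclasses eauto.
  assert (Hquot : forall y, y <> z ->
    Cmod (f y - f z - l * (y - z)) = (Cmod ((f y - f z) / (y - z) - l) * Cmod (y - z))%R).
  { intros y Hy. apply Cminus_eq_contra in Hy. rewrite <- Cmod_mult. f_equal. now field. }
  unfold locally', within.
  split; intros H eps He.
  - generalize (H (eps / 2)%R ltac:(lra)). apply filter_imp. intros y Hy Hyz.
    rewrite (Hquot y Hyz) in Hy.
    apply Rmult_le_reg_r in Hy; [lra|]. now apply Cmod_gt_0, Cminus_eq_contra.
  - generalize (H eps He). apply filter_imp. intros y Hy.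
    destruct (Ceq_dec y z) as [->|Hyz].
    + replace (f z - f z - l * (z - z)) with (RtoC 0) by ring.
      rewrite Cmod_0. apply Rmult_le_pos; [lra | apply Cmod_ge_0].
    + rewrite (Hquot y Hyz). apply Rmult_le_compat_r; [apply Cmod_ge_0 | now apply Rlt_le, Hy].
Qed.

Lemma Cderivable_continuous (f : C -> C) (z : C) :
  Cderivable f z -> filterlim f (nhds z) (nhds (f z)).
Proof.
  intros [l H]. apply Cderiv_AbsRing in H.
  apply (ex_derive_continuous (V := AbsRing_NormedModule C_AbsRing)). now exists l.
Qed.

Lemma Cderivable_lim (f : C -> C) (z : C) :
  Cderivable f z -> filterlim f (nhds' z) (nhds (f z)).
Proof.
  intros H. eapply filterlim_filter_le_1; [apply filter_le_within|].
  now apply Cderivable_continuous.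
Qed.

Lemma Cderiv_eq (f : C -> C) (z l l' : C) : Cderiv f z l -> l = l' -> Cderiv f z l'.
Proof. now intros H <-. Qed.

Lemma Cderiv_ext_loc (f g : C -> C) (z l : C) :
  nhds z (fun y => f y = g y) -> Cderiv f z l -> Cderiv g z l.
Proof. exact (is_derive_ext_loc (K := C_AbsRing) (V := C_NormedModule) f g z l). Qed.

Lemma Cderiv_const (c z : C) : Cderiv (fun _ => c) z 0.
Proof. exact (is_derive_const (K := C_AbsRing) (V := C_NormedModule) c z). Qed.

Lemma Cderiv_id (z : C) : Cderiv (fun x => x) z 1.
Proof. apply Cderiv_AbsRing. exact (is_derive_id (K := C_AbsRing) z). Qed.

Lemma Cderiv_plus (f g : C -> C) (z a b : C) :
  Cderiv f z a -> Cderiv g z b -> Cderiv (fun x => f x + g x) z (a + b).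
Proof. exact (is_derive_plus (K := C_AbsRing) (V := C_NormedModule) f g z a b). Qed.

Lemma Cderiv_minus (f g : C -> C) (z a b : C) :
  Cderiv f z a -> Cderiv g z b -> Cderiv (fun x => f x - g x) z (a - b).
Proof. exact (is_derive_minus (K := C_AbsRing) (V := C_NormedModule) f g z a b). Qed.

Lemma Cderiv_mult (f g : C -> C) (z a b : C) :
  Cderiv f z a -> Cderiv g z b -> Cderiv (fun x => f x * g x) z (a * g z + f z * b).
Proof.
  rewrite !Cderiv_AbsRing. intros Hf Hg.
  exact (is_derive_mult (K := C_AbsRing) f g z a b Hf Hg Cmult_comm).
Qed.

Lemma Cderiv_comp (f g : C -> C) (z a b : C) :
  Cderiv f (g z) a -> Cderiv g z b -> Cderiv (fun x => f (g x)) z (b * a).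
Proof.
  rewrite !Cderiv_AbsRing.
  exact (is_derive_comp (K := C_AbsRing) (V := AbsRing_NormedModule C_AbsRing) f g z a b).
Qed.

Lemma nhds_neq_0 (z : C) : z <> 0 -> nhds z (fun y : C => y <> 0).
Proof.
  intros Hz. apply nhds_iff. exists (Cmod z). split; [now apply Cmod_gt_0|].
  intros y Hy ->. replace (0 - z) with (- z) in Hy by ring. rewrite Cmod_opp in Hy. lra.
Qed.

Lemma Cderiv_Cinv (z : C) : z <> 0 -> Cderiv Cinv z (- (/ z * / z)).
Proof.
  intros Hz. apply Cderiv_iff_lim.
  apply (filterlim_ext_loc (fun y => (- / z) * / y)).
  - unfold locally', within. generalize (nhds_neq_0 z Hz). apply filter_imp. intros y Hy Hyz.
    apply Cminus_eq_contra in Hyz. field. auto.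
  - apply (Clim_eq _ (- / z * / z)); [|ring].
    apply Clim_mult; [apply Clim_const | apply Clim_inv; [exact Hz | apply Clim_id]].
Qed.

Lemma Cderiv_inv (f : C -> C) (z a : C) :
  f z <> 0 -> Cderiv f z a -> Cderiv (fun x => / f x) z (- a / (f z * f z)).
Proof.
  intros Hz Hf. eapply Cderiv_eq.
  - apply (Cderiv_comp Cinv f); [now apply Cderiv_Cinv | exact Hf].
  - field. exact Hz.
Qed.

Lemma Cderivable_const (c z : C) : Cderivable (fun _ => c) z.
Proof. eexists. apply Cderiv_const. Qed.

Lemma Cderivable_id (z : C) : Cderivable (fun x => x) z.
Proof. eexists. apply Cderiv_id. Qed.

Lemma Cderivable_minus (f g : C -> C) (z : C) :
  Cderivable f z -> Cderivable g z -> Cderivable (fun x => f x - g x) z.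
Proof. intros [a Hf] [b Hg]. eexists. now apply Cderiv_minus; [apply Hf | apply Hg]. Qed.

Lemma Cderivable_mult (f g : C -> C) (z : C) :
  Cderivable f z -> Cderivable g z -> Cderivable (fun x => f x * g x) z.
Proof. intros [a Hf] [b Hg]. eexists. now apply Cderiv_mult; [apply Hf | apply Hg]. Qed.

Lemma Cderivable_div (f g : C -> C) (z : C) : g z <> 0 ->
  Cderivable f z -> Cderivable g z -> Cderivable (fun x => f x / g x) z.
Proof.
  intros Hz Hf [b Hg]. apply Cderivable_mult; [exact Hf|].
  eexists. apply Cderiv_inv; [exact Hz | exact Hg].
Qed.

Lemma Cderivable_shift (f : C -> C) (c z : C) :
  Cderivable f (c + z) -> Cderivable (fun x => f (c + x)) z.
Proof.
  intros [l Hf]. eexists. apply (Cderiv_comp f (fun x => c + x)); [exact Hf|].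
  apply Cderiv_plus; [apply Cderiv_const | apply Cderiv_id].
Qed.

(** * Functions on real lines *)

Lemma Cderiv_along_line (f : C -> C) (z v l : C) (t : R) :
  Cderiv f (z + t * v) l ->
  is_derive (K := R_AbsRing) (V := C_R_NormedModule) (fun s : R => f (z + s * v)) t (v * l).
Proof.
  intros H. split; [apply is_linear_scal_l|]. intros x Hx eps.
  apply (is_filter_lim_locally_unique (V := R_NormedModule)) in Hx as <-.
  assert (Hv := Cmod_ge_0 v).
  assert (He : (0 < eps / (1 + Cmod v))%R) by (apply Rdiv_lt_0_compat; [apply cond_pos | lra]).
  apply Cderiv_iff with (eps := (eps / (1 + Cmod v))%R) in H; [|exact He].
  apply nhds_iff in H as [d [Hd H]].
  assert (Hd' : (0 < d / (1 + Cmod v))%R) by (apply Rdiv_lt_0_compat; lra).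
  exists (mkposreal _ Hd'). intros s Hs.
  change (Rabs (s - t) < d / (1 + Cmod v))%R in Hs. apply Rlt_div_r in Hs; [|lra].
  assert (Hst := Rabs_pos (s - t)).
  specialize (H (z + s * v)).
  replace (z + s * v - (z + t * v)) with ((s - t)%R * v) in H by (rewrite RtoC_minus; ring).
  rewrite Cmod_mult, Cmod_R in H. specialize (H ltac:(nra)).
  rewrite <- Cmod_norm. rewrite scal_R_Cmult.
  change (Cmod (f (z + s * v) - f (z + t * v) - (s - t)%R * (v * l))%C <= eps * Rabs (s - t))%R.
  replace ((s - t)%R * (v * l)) with (l * ((s - t)%R * v)) by ring.
  eapply Rle_trans; [exact H|].
  replace (eps / (1 + Cmod v) * (Rabs (s - t) * Cmod v))%R
    with (eps * Rabs (s - t) * (Cmod v / (1 + Cmod v)))%R by (field; lra).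
  rewrite <- Rmult_1_r. apply Rmult_le_compat_l.
  - assert (He' := cond_pos eps). nra.
  - apply Rle_div_l; lra.
Qed.

Lemma Cderiv_horizontal (f : C -> C) (x y : R) (l : C) : Cderiv f (x, y) l ->
  is_derive (K := R_AbsRing) (V := C_R_NormedModule) (fun s : R => f (s, y)) x l.
Proof.
  intros H.
  assert (Hline : forall s : R, (0, y) + s * 1 = (s, y))
    by (intros; apply injective_projections; simpl; ring).
  apply (is_derive_ext (fun s : R => f ((0, y) + s * 1))); [intros s; now rewrite Hline|].
  replace l with (1 * l) by ring. apply Cderiv_along_line. now rewrite Hline.
Qed.

Lemma Cderiv_vertical (f : C -> C) (x y : R) (l : C) : Cderiv f (x, y) l ->
  is_derive (K := R_AbsRing) (V := C_R_NormedModule) (fun s : R => f (x, s)) y (Ci * l).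
Proof.
  intros H.
  assert (Hline : forall s : R, (x, 0) + s * Ci = (x, s))
    by (intros; apply injective_projections; simpl; ring).
  apply (is_derive_ext (fun s : R => f ((x, 0) + s * Ci))); [intros s; now rewrite Hline|].
  apply Cderiv_along_line. now rewrite Hline.
Qed.

Lemma Cderivable_continuous_horizontal (f : C -> C) (x y : R) : Cderivable f (x, y) ->
  continuous (T := R_UniformSpace) (U := C_R_NormedModule) (fun s : R => f (s, y)) x.
Proof.
  intros [l H]. apply (ex_derive_continuous (K := R_AbsRing) (V := C_R_NormedModule)).
  exists l. now apply Cderiv_horizontal.
Qed.

Lemma Cderivable_continuous_vertical (f : C -> C) (x y : R) : Cderivable f (x, y) ->
  continuous (T := R_UniformSpace) (U := C_R_NormedModule) (fun s : R => f (x, s)) y.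
Proof.
  intros [l H]. apply (ex_derive_continuous (K := R_AbsRing) (V := C_R_NormedModule)).
  exists (Ci * l). now apply Cderiv_vertical.
Qed.

Notation CInt := (RInt (V := C_R_CompleteNormedModule)).
Notation ex_CInt := (ex_RInt (V := C_R_NormedModule)).

Lemma Cmod_CInt_le (f : R -> C) (a b M : R) : (a <= b)%R -> ex_CInt f a b ->
  (forall t, (a <= t <= b)%R -> Cmod (f t) <= M) ->
  (Cmod (CInt f a b) <= (b - a) * M)%R.
Proof.
  intros Hab Hf HM. rewrite Cmod_norm.
  apply (norm_RInt_le_const (V := C_R_NormedModule) f); [exact Hab | |].
  - intros t Ht. rewrite <- Cmod_norm. now apply HM.
  - now apply (RInt_correct (V := C_R_CompleteNormedModule)).
Qed.

(** * Rectangle induction *)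

Open Scope R_scope.

Lemma is_lim_seq_halving (L : R) : is_lim_seq (fun n => L / 2 ^ n) 0.
Proof.
  apply (is_lim_seq_ext (fun n => L * (/ 2) ^ n)).
  - intros n. now rewrite pow_inv.
  - replace (Finite 0) with (Rbar_mult L 0) by (simpl; now rewrite Rmult_0_r).
    apply is_lim_seq_scal_l, is_lim_seq_geom. rewrite Rabs_right; lra.
Qed.

Lemma nested_halves (u v : nat -> R) : u O <= v O ->
  (forall n, u n <= u (S n) /\ v (S n) <= v n /\ v (S n) - u (S n) = (v n - u n) / 2) ->
  (forall n, v n - u n = (v O - u O) / 2 ^ n) /\ exists x, forall n, u n <= x <= v n.
Proof.
  intros Huv0 H.
  assert (Hlen : forall n, v n - u n = (v O - u O) / 2 ^ n).
  { induction n as [|n IH]; [simpl; field|].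
    destruct (H n) as (_ & _ & ->). rewrite IH. simpl. field. apply pow_nonzero; lra. }
  split; [exact Hlen|].
  destruct (ex_lim_seq_adj u v) as (Hu & Hv & Elim); try apply H.
  { apply (is_lim_seq_ext (fun n => (v O - u O) / 2 ^ n)); [now intros n|].
    apply is_lim_seq_halving. }
  exists (real (Lim_seq u)). intros n. split.
  - apply (is_lim_seq_incr_compare u); [now apply Lim_seq_correct' | apply H].
  - rewrite Elim. apply (is_lim_seq_decr_compare v); [now apply Lim_seq_correct' | apply H].
Qed.

Definition half_size (s r : (R * R) * (R * R)) : Prop :=
  let '((a, b), (c, d)) := r in let '((a', b'), (c', d')) := s in
  (a <= a' /\ b' <= b /\ b' - a' = (b - a) / 2) /\
  (c <= c' /\ d' <= d /\ d' - c' = (d - c) / 2).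

Lemma nested_half_size (q : nat -> (R * R) * (R * R)) (a b c d : R) :
  a <= b -> c <= d -> q O = ((a, b), (c, d)) -> (forall n, half_size (q (S n)) (q n)) ->
  exists x y, forall n, let '((u, v), (s, t)) := q n in
    (u <= x <= v /\ v - u = (b - a) / 2 ^ n) /\ (s <= y <= t /\ t - s = (d - c) / 2 ^ n).
Proof.
  intros Hab Hcd Hq0 Hq.
  destruct (nested_halves (fun n => fst (fst (q n))) (fun n => snd (fst (q n)))) as [Hw [x Hx]].
  { now rewrite Hq0. }
  { intros n. specialize (Hq n). destruct (q n) as [[] []], (q (S n)) as [[] []]. apply Hq. }
  destruct (nested_halves (fun n => fst (snd (q n))) (fun n => snd (snd (q n)))) as [Hh [y Hy]].
  { now rewrite Hq0. }
  { intros n. specialize (Hq n). destruct (q n) as [[] []], (q (S n)) as [[] []]. apply Hq. }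
  exists x, y. intros n. specialize (Hx n). specialize (Hy n). specialize (Hw n). specialize (Hh n).
  rewrite Hq0 in Hw, Hh. destruct (q n) as [[] []]. now split; split.
Qed.

(* Bisect: if [P] fails, it fails on nested rectangles shrinking to a point. *)
Lemma rectangle_induction (P : R -> R -> R -> R -> Prop) (a b c d : R) : a <= b -> c <= d ->
  (forall u v s t, u <= v -> s <= t -> let m := (u + v) / 2 in let n := (s + t) / 2 in
     P u m s n -> P m v s n -> P u m n t -> P m v n t -> P u v s t) ->
  (forall x y, a <= x <= b -> c <= y <= d -> exists delta, 0 < delta /\
     forall u v s t, u <= x <= v -> s <= y <= t -> v - u < delta -> t - s < delta -> P u v s t) ->
  P a b c d.
Proof.
  intros Hab Hcd Hquarters Hlocal. apply NNPP. intros Hbad.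
  set (bad := fun r : (R * R) * (R * R) => let '((u, v), (s, t)) := r in
    u <= v /\ s <= t /\ ~ P u v s t).
  set (worse := fun r s => half_size s r /\ bad s).
  assert (Hworse : forall r, bad r -> exists s, worse r s).
  { intros [[u v] [s t]] (Huv & Hst & HP). apply NNPP. intros Hn.
    assert (HQ : forall u' v' s' t', u' <= v' -> s' <= t' ->
      half_size ((u', v'), (s', t')) ((u, v), (s, t)) -> P u' v' s' t').
    { intros u' v' s' t' Huv' Hst' Hhalf. apply NNPP. intros HP'. apply Hn.
      exists ((u', v'), (s', t')). exact (conj Hhalf (conj Huv' (conj Hst' HP'))). }
    apply HP, Hquarters; auto; apply HQ; simpl; lra. }
  set (step := fun r => epsilon (inhabits r) (worse r)).
  set (q := fun n => Nat.iter n step ((a, b), (c, d))).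
  assert (Hstep : forall n, bad (q n) -> worse (q n) (q (S n))).
  { intros n Hn. apply (epsilon_spec (inhabits (q n)) (worse (q n))), Hworse, Hn. }
  assert (Hq : forall n, bad (q n)).
  { induction n as [|n IH]; [now repeat split | now apply Hstep]. }
  assert (Hhalf : forall n, half_size (q (S n)) (q n)) by (intros n; apply Hstep, Hq).
  destruct (nested_half_size q a b c d Hab Hcd eq_refl Hhalf) as (x & y & Hxy).
  destruct (Hlocal x y) as [delta [Hdelta HP]]; [apply (Hxy O) | apply (Hxy O) |].
  assert (Hsmall : forall L, eventually (fun n => L / 2 ^ n < delta)).
  { intros L. apply (is_lim_seq_halving L (fun l => l < delta)). now apply (open_lt delta 0). }
  destruct (filter_and _ _ (Hsmall (b - a)) (Hsmall (d - c))) as [N HN].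
  destruct (HN N (Nat.le_refl N)) as [HNw HNh].
  specialize (Hxy N). specialize (Hq N).
  destruct (q N) as [[u v] [s t]], Hxy as [[Hx Hw] [Hy Hh]].
  apply Hq, HP; lra.
Qed.

(** * Integrals over the boundary of a rectangle *)

Definition rect_integrable (f : C -> C) (a b c d : R) : Prop :=
  (ex_CInt (fun x => f (x, c)) a b /\ ex_CInt (fun x => f (x, d)) a b) /\
  (ex_CInt (fun y => f (a, y)) c d /\ ex_CInt (fun y => f (b, y)) c d).

Definition rect_integral (f : C -> C) (a b c d : R) : C :=
  (CInt (fun x => f (x, c)) a b - CInt (fun x => f (x, d)) a b
   + Ci * (CInt (fun y => f (b, y)) c d - CInt (fun y => f (a, y)) c d))%C.

Definition Cderivable_on_rect (f : C -> C) (a b c d : R) : Prop :=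
  forall x y, a <= x <= b -> c <= y <= d -> Cderivable f (x, y).

Definition on_rect_boundary (a b c d x y : R) : Prop :=
  ((x = a \/ x = b) /\ c <= y <= d) \/ (a <= x <= b /\ (y = c \/ y = d)).

Lemma Cderivable_rect_integrable (f : C -> C) (a b c d : R) : a <= b -> c <= d ->
  (forall x y, on_rect_boundary a b c d x y -> Cderivable f (x, y)) ->
  rect_integrable f a b c d.
Proof.
  intros Hab Hcd H. unfold on_rect_boundary in H.
  repeat split; apply (ex_RInt_continuous (V := C_R_CompleteNormedModule));
    rewrite Rmin_left, Rmax_right by lra; intros t Ht;
    (apply Cderivable_continuous_horizontal || apply Cderivable_continuous_vertical);
    apply H; tauto.
Qed.

Lemma rect_integrable_minus (f g : C -> C) (a b c d : R) :
  rect_integrable f a b c d -> rect_integrable g a b c d ->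
  rect_integrable (fun z => f z - g z)%C a b c d.
Proof.
  intros [[] []] [[] []].
  repeat split; now apply (ex_RInt_minus (V := C_R_NormedModule)).
Qed.

Lemma rect_integral_minus (f g : C -> C) (a b c d : R) :
  rect_integrable f a b c d -> rect_integrable g a b c d ->
  rect_integral (fun z => f z - g z)%C a b c d
    = (rect_integral f a b c d - rect_integral g a b c d)%C.
Proof.
  intros [[] []] [[] []]. unfold rect_integral.
  assert (Hminus : forall u v s t, ex_CInt u s t -> ex_CInt v s t ->
    CInt (fun x => u x - v x)%C s t = (CInt u s t - CInt v s t)%C)
    by exact (RInt_minus (V := C_R_CompleteNormedModule)).
  rewrite !Hminus by assumption. ring.
Qed.

Lemma CInt_scal (c : C) (f : R -> C) (a b : R) : ex_CInt f a b ->
  CInt (fun t => c * f t)%C a b = (c * CInt f a b)%C.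
Proof.
  intros Hf. apply (is_RInt_unique (V := C_R_CompleteNormedModule)).
  apply (RInt_correct (V := C_R_CompleteNormedModule)) in Hf.
  assert (HRe := is_RInt_fct_extend_fst (U := R_NormedModule) (V := R_NormedModule) _ _ _ _ Hf).
  assert (HIm := is_RInt_fct_extend_snd (U := R_NormedModule) (V := R_NormedModule) _ _ _ _ Hf).
  apply (is_RInt_fct_extend_pair (U := R_NormedModule) (V := R_NormedModule)).
  - exact (is_RInt_minus _ _ _ _ _ _
      (is_RInt_scal _ _ _ (fst c) _ HRe) (is_RInt_scal _ _ _ (snd c) _ HIm)).
  - exact (is_RInt_plus _ _ _ _ _ _
      (is_RInt_scal _ _ _ (fst c) _ HIm) (is_RInt_scal _ _ _ (snd c) _ HRe)).
Qed.

Lemma rect_integral_scal (k : C) (f : C -> C) (a b c d : R) : rect_integrable f a b c d ->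
  rect_integral (fun z => k * f z)%C a b c d = (k * rect_integral f a b c d)%C.
Proof.
  intros [[] []]. unfold rect_integral. rewrite !CInt_scal by assumption. ring.
Qed.

Lemma Cmod_rect_integral_le (f : C -> C) (a b c d M : R) : a <= b -> c <= d ->
  rect_integrable f a b c d ->
  (forall x y, on_rect_boundary a b c d x y -> Cmod (f (x, y)) <= M) ->
  Cmod (rect_integral f a b c d) <= 2 * ((b - a) + (d - c)) * M.
Proof.
  intros Hab Hcd [[Hbot Htop] [Hleft Hright]] HM. unfold rect_integral, on_rect_boundary in *.
  apply Cmod_CInt_le with (M := M) in Hbot, Htop, Hleft, Hright;
    try lra; try (intros t Ht; apply HM; tauto).
  set (bottom := CInt _ a b) in *. set (top := CInt (fun x => f (x, d)) a b) in *.
  set (right := CInt (fun y => f (b, y)) c d) in *. set (left := CInt _ c d) in *.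
  assert (Htri := Cmod_triangle (bottom - top) (Ci * (right - left))).
  rewrite Cmod_mult, Cmod_Ci in Htri.
  assert (Hbt := Cmod_minus_le bottom top). assert (Hrl := Cmod_minus_le right left). lra.
Qed.

Lemma CInt_Chasles (f : R -> C) (a m b : R) : a <= m <= b -> ex_CInt f a b ->
  CInt f a b = (CInt f a m + CInt f m b)%C.
Proof.
  intros Hm Hf. symmetry.
  apply (RInt_Chasles (V := C_R_CompleteNormedModule)).
  - now apply (ex_RInt_Chasles_1 (V := C_R_CompleteNormedModule)) with b.
  - now apply (ex_RInt_Chasles_2 (V := C_R_CompleteNormedModule)) with a.
Qed.

Lemma rect_integral_split_x (f : C -> C) (a m b c d : R) : a <= m <= b ->
  rect_integrable f a b c d ->
  rect_integral f a b c d = (rect_integral f a m c d + rect_integral f m b c d)%C.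
Proof.
  intros Hm [[Hbot Htop] _]. unfold rect_integral.
  rewrite (CInt_Chasles _ a m b Hm Hbot), (CInt_Chasles _ a m b Hm Htop). ring.
Qed.

Lemma rect_integral_split_y (f : C -> C) (a b c m d : R) : c <= m <= d ->
  rect_integrable f a b c d ->
  rect_integral f a b c d = (rect_integral f a b c m + rect_integral f a b m d)%C.
Proof.
  intros Hm [_ [Hleft Hright]]. unfold rect_integral.
  rewrite (CInt_Chasles _ c m d Hm Hleft), (CInt_Chasles _ c m d Hm Hright). ring.
Qed.

Lemma rect_integral_primitive (F f : C -> C) (a b c d : R) : a <= b -> c <= d ->
  (forall x y, on_rect_boundary a b c d x y -> Cderiv F (x, y) (f (x, y))) ->
  (forall x y, on_rect_boundary a b c d x y -> Cderivable f (x, y)) ->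
  rect_integral f a b c d = 0.
Proof.
  intros Hab Hcd HF Hf. unfold on_rect_boundary in *.
  assert (Hx : forall y, y = c \/ y = d ->
    CInt (fun x => f (x, y)) a b = (F (b, y) - F (a, y))%C).
  { intros y Hy. apply (is_RInt_unique (V := C_R_CompleteNormedModule)).
    apply (is_RInt_derive (V := C_R_CompleteNormedModule) (fun x => F (x, y)));
      rewrite Rmin_left, Rmax_right by lra; intros x Hx.
    - apply Cderiv_horizontal, HF. tauto.
    - apply Cderivable_continuous_horizontal, Hf. tauto. }
  assert (Hy : forall x, x = a \/ x = b ->
    CInt (fun y => f (x, y)) c d = (- Ci * F (x, d) - - Ci * F (x, c))%C).
  { intros x Hx'. apply (is_RInt_unique (V := C_R_CompleteNormedModule)).
    apply (is_RInt_derive (V := C_R_CompleteNormedModule) (fun y => - Ci * F (x, y))%C);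
      rewrite Rmin_left, Rmax_right by lra; intros y Hy.
    - replace (f (x, y)) with (Ci * (0 * F (x, y) + - Ci * f (x, y)))%C
        by (apply injective_projections; simpl; ring).
      apply (Cderiv_vertical (fun z => - Ci * F z)%C).
      apply (Cderiv_mult (fun _ => - Ci)%C F); [apply Cderiv_const|]. apply HF. tauto.
    - apply Cderivable_continuous_vertical, Hf. tauto. }
  unfold rect_integral. rewrite !Hx, !Hy by tauto.
  apply injective_projections; simpl; ring.
Qed.

Lemma Cderivable_on_rect_sub (f : C -> C) (a b c d a' b' c' d' : R) :
  Cderivable_on_rect f a b c d -> a <= a' -> b' <= b -> c <= c' -> d' <= d ->
  Cderivable_on_rect f a' b' c' d'.
Proof. intros H ? ? ? ? x y Hx Hy. apply H; lra. Qed.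

Lemma Cderivable_on_rect_integrable (f : C -> C) (a b c d : R) : a <= b -> c <= d ->
  Cderivable_on_rect f a b c d -> rect_integrable f a b c d.
Proof.
  intros Hab Hcd H. apply Cderivable_rect_integrable; try assumption.
  intros x y Hxy. apply H; unfold on_rect_boundary in Hxy; lra.
Qed.
(** * Goursat's theorem and Cauchy's formula *)

Lemma rect_integral_split_quarters (f : C -> C) (a m b c n d : R) :
  a <= m <= b -> c <= n <= d -> Cderivable_on_rect f a b c d ->
  rect_integral f a b c d
    = (rect_integral f a m c n + rect_integral f m b c n
       + (rect_integral f a m n d + rect_integral f m b n d))%C.
Proof.
  intros Hm Hn Hf.
  rewrite (rect_integral_split_y f a b c n d Hn), !(rect_integral_split_x f a m b _ _ Hm);
    try reflexivity; apply Cderivable_on_rect_integrable; try lra;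
    apply (Cderivable_on_rect_sub f a b c d); auto; lra.
Qed.

Lemma Cderiv_affine (k l z : C) : Cderiv (fun y => k + l * y)%C z l.
Proof.
  eapply Cderiv_eq.
  - apply Cderiv_plus; [apply Cderiv_const|].
    apply Cderiv_mult; [apply Cderiv_const | apply Cderiv_id].
  - simpl. ring.
Qed.

Lemma rect_integral_affine (k l : C) (a b c d : R) : a <= b -> c <= d ->
  rect_integral (fun z => k + l * z)%C a b c d = 0.
Proof.
  intros Hab Hcd.
  apply (rect_integral_primitive (fun z => z * (k + l / 2 * z))%C); try assumption; intros x y _.
  - eapply Cderiv_eq; [apply Cderiv_mult; [apply Cderiv_id | apply Cderiv_affine]|].
    generalize ((x, y) : C). intros z. field.
  - eexists. apply Cderiv_affine.
Qed.

Lemma Cmod_pair_sub_le (x y x' y' : R) :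
  Cmod ((x, y) - (x', y'))%C <= Rabs (x - x') + Rabs (y - y').
Proof.
  replace ((x, y) - (x', y'))%C with ((x - x')%R + Ci * (y - y')%R)%C
    by (apply injective_projections; simpl; ring).
  eapply Rle_trans; [apply Cmod_triangle|].
  rewrite Cmod_mult, Cmod_Ci, !Cmod_R. lra.
Qed.

Lemma rect_integral_local_bound (f : C -> C) (x y eps : R) : Cderivable f (x, y) -> 0 < eps ->
  exists delta, 0 < delta /\ forall a b c d, a <= x <= b -> c <= y <= d ->
    b - a < delta -> d - c < delta -> rect_integrable f a b c d ->
    Cmod (rect_integral f a b c d) <= 2 * eps * ((b - a) + (d - c)) ^ 2.
Proof.
  intros [l Hl] He.
  destruct (proj1 (nhds_iff _ _) (proj1 (Cderiv_iff f (x, y) l) Hl eps He)) as [delta [Hd Hf]].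
  exists (delta / 2). split; [lra|]. intros a b c d Hx Hy Hab Hcd Hint.
  set (g := (fun z => (f (x, y) - l * (x, y)) + l * z)%C).
  assert (Hg : rect_integrable g a b c d).
  { apply Cderivable_rect_integrable; try lra. intros. eexists. apply Cderiv_affine. }
  assert (Ediff : rect_integral f a b c d = rect_integral (fun z => f z - g z)%C a b c d).
  { rewrite rect_integral_minus by assumption. unfold g.
    rewrite rect_integral_affine by lra. ring. }
  set (L := (b - a) + (d - c)). rewrite Ediff.
  replace (2 * eps * L ^ 2) with (2 * L * (eps * L)) by ring.
  apply Cmod_rect_integral_le; try lra.
  { now apply rect_integrable_minus. }
  intros s t Hst.
  assert (Hdist : Cmod ((s, t) - (x, y))%C <= L).
  { eapply Rle_trans; [apply Cmod_pair_sub_le|]. unfold L, on_rect_boundary in *.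
    apply Rplus_le_compat; apply Rabs_le; lra. }
  replace (f (s, t) - g (s, t))%C with (f (s, t) - f (x, y) - l * ((s, t) - (x, y)))%C
    by (unfold g; ring).
  eapply Rle_trans; [apply Hf; unfold L in Hdist; lra|]. apply Rmult_le_compat_l; lra.
Qed.

Lemma Cmod_rect_integral_le_eps (f : C -> C) (a b c d eps : R) : a <= b -> c <= d ->
  Cderivable_on_rect f a b c d -> 0 < eps ->
  Cmod (rect_integral f a b c d) <= 2 * eps * ((b - a) + (d - c)) ^ 2.
Proof.
  intros Hab Hcd Hf He.
  refine (rectangle_induction (fun u v s t =>
    a <= u <= v /\ v <= b -> c <= s <= t /\ t <= d ->
    Cmod (rect_integral f u v s t) <= 2 * eps * ((v - u) + (t - s)) ^ 2)
    a b c d Hab Hcd _ _ _ _); try lra.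
  - intros u v s t Huv Hst m n Hbl Hbr Htl Htr Hx Hy.
    assert (Hmu : m - u = (v - u) / 2) by (unfold m; lra).
    assert (Hvm : v - m = (v - u) / 2) by (unfold m; lra).
    assert (Hns : n - s = (t - s) / 2) by (unfold n; lra).
    assert (Htn : t - n = (t - s) / 2) by (unfold n; lra).
    specialize (Hbl ltac:(lra) ltac:(lra)). specialize (Hbr ltac:(lra) ltac:(lra)).
    specialize (Htl ltac:(lra) ltac:(lra)). specialize (Htr ltac:(lra) ltac:(lra)).
    rewrite Hmu, Hns in Hbl. rewrite Hvm, Hns in Hbr.
    rewrite Hmu, Htn in Htl. rewrite Hvm, Htn in Htr.
    rewrite (rect_integral_split_quarters f u m v s n t);
      [| lra | lra | apply (Cderivable_on_rect_sub f a b c d); auto; lra].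
    eapply Rle_trans; [apply Cmod_triangle|].
    eapply Rle_trans; [apply Rplus_le_compat; apply Cmod_triangle|]. lra.
  - intros x y Hx Hy.
    destruct (rect_integral_local_bound f x y eps (Hf x y Hx Hy) He) as [delta [Hd Hloc]].
    exists delta. split; [exact Hd|]. intros u v s t Hux Hsy Hw Hh Hu Hs.
    apply Hloc; auto. apply Cderivable_on_rect_integrable; try lra.
    apply (Cderivable_on_rect_sub f a b c d); auto; lra.
Qed.

Lemma Rle_0_of_le_eps_mult (x K : R) : (forall eps, 0 < eps <= 1 -> x <= eps * K) -> x <= 0.
Proof.
  intros H. apply le_epsilon. intros eps He.
  assert (HK := Rabs_pos K). assert (HK' := Rle_abs K).
  set (e := eps / (eps + Rabs K)).
  assert (Ee : e * (eps + Rabs K) = eps) by (unfold e; field; lra).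
  assert (He0 : 0 < e) by (apply Rdiv_lt_0_compat; lra).
  assert (He1 : e <= 1) by (apply Rle_div_l; lra).
  specialize (H e (conj He0 He1)). nra.
Qed.

Lemma Goursat (f : C -> C) (a b c d : R) : a <= b -> c <= d ->
  Cderivable_on_rect f a b c d -> rect_integral f a b c d = 0.
Proof.
  intros Hab Hcd Hf. apply Cmod_eq_0, Rle_antisym; [|apply Cmod_ge_0].
  apply (Rle_0_of_le_eps_mult _ (2 * ((b - a) + (d - c)) ^ 2)). intros eps [He _].
  assert (H := Cmod_rect_integral_le_eps f a b c d eps Hab Hcd Hf He). lra.
Qed.

Lemma rect_integral_inner (f : C -> C) (a b c d a' b' c' d' : R) :
  a <= a' <= b' /\ b' <= b -> c <= c' <= d' /\ d' <= d ->
  (forall x y, a <= x <= b -> c <= y <= d -> ~ (a' < x < b' /\ c' < y < d') ->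
     Cderivable f (x, y)) ->
  rect_integral f a b c d = rect_integral f a' b' c' d'.
Proof.
  intros Hx Hy Hf.
  rewrite (rect_integral_split_x f a a' b), (rect_integral_split_x f a' b' b),
    (rect_integral_split_y f a' b' c c' d), (rect_integral_split_y f a' b' c' d' d);
    try lra;
    try (apply Cderivable_rect_integrable; try lra;
         intros x y Hxy; unfold on_rect_boundary in Hxy; apply Hf; lra).
  rewrite (Goursat f a a'), (Goursat f b' b), (Goursat f a' b' c c'), (Goursat f a' b' d' d);
    try lra; try (intros x y ? ?; apply Hf; lra).
  ring.
Qed.

Definition Csup (z : C) : R := Rmax (Rabs (Re z)) (Rabs (Im z)).

Lemma Csup_le_iff (x y a : R) : Csup (x, y) <= a <-> -a <= x <= a /\ -a <= y <= a.
Proof.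
  unfold Csup. rewrite <- !Rabs_le_between. split.
  - intros H. split; (eapply Rle_trans; [|exact H]); [apply Rmax_l | apply Rmax_r].
  - intros []. now apply Rmax_lub.
Qed.

Lemma Csup_le_Cmod (z : C) : Csup z <= Cmod z.
Proof. apply Rmax_Cmod. Qed.

Lemma Cmod_le_Csup (z : C) : Cmod z <= 2 * Csup z.
Proof.
  destruct z as [x y].
  replace (x, y) with ((x, y) - (0, 0))%C by (apply injective_projections; simpl; ring).
  eapply Rle_trans; [apply Cmod_pair_sub_le|]. rewrite !Rminus_0_r.
  replace ((x, y) - (0, 0))%C with ((x, y) : C) by (apply injective_projections; simpl; ring).
  unfold Csup; simpl.
  assert (Hl := Rmax_l (Rabs x) (Rabs y)). assert (Hr := Rmax_r (Rabs x) (Rabs y)). lra.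
Qed.

Lemma Csup_boundary (x y a : R) : 0 <= a -> on_rect_boundary (-a) a (-a) a x y -> Csup (x, y) = a.
Proof.
  intros Ha Hxy. apply Rle_antisym.
  - apply Csup_le_iff. unfold on_rect_boundary in Hxy. lra.
  - unfold Csup; simpl.
    assert (Hl := Rmax_l (Rabs x) (Rabs y)). assert (Hr := Rmax_r (Rabs x) (Rabs y)).
    assert (Hx := Rle_abs x). assert (Hy := Rle_abs y).
    assert (Hx' := Rle_abs (- x)). assert (Hy' := Rle_abs (- y)). rewrite Rabs_Ropp in Hx', Hy'.
    destruct Hxy as [[[] _]|[_ []]]; lra.
Qed.

Definition square_integral (f : C -> C) (a : R) : C := rect_integral f (-a) a (-a) a.

Lemma Cmod_square_integral_le (f : C -> C) (a M : R) : 0 < a ->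
  (forall z, Csup z = a -> Cderivable f z) -> (forall z, Csup z = a -> Cmod (f z) <= M) ->
  Cmod (square_integral f a) <= 8 * a * M.
Proof.
  intros Ha Hf HM. replace (8 * a * M) with (2 * ((a - - a) + (a - - a)) * M) by ring.
  apply Cmod_rect_integral_le; try lra.
  - apply Cderivable_rect_integrable; try lra.
    intros x y Hxy. apply Hf, Csup_boundary; [lra | exact Hxy].
  - intros x y Hxy. apply HM, Csup_boundary; [lra | exact Hxy].
Qed.

Lemma square_integral_removable (g : C -> C) (a : R) : 0 < a ->
  (forall z, Csup z <= a -> z <> 0 -> Cderivable g z) ->
  filterlim (fun z => z * g z)%C (nhds' 0) (nhds 0) ->
  square_integral g a = 0.
Proof.
  intros Ha Hg Hlim. apply Cmod_eq_0, Rle_antisym; [|apply Cmod_ge_0].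
  apply (Rle_0_of_le_eps_mult _ 8). intros eps [He _].
  rewrite filterlim_nhds in Hlim by typeclasses eauto.
  destruct (proj1 (nhds'_0_iff _) (Hlim eps He)) as [d [Hd Hzg]].
  set (e := Rmin a (d / 4)).
  assert (He0 : 0 < e) by (apply Rmin_pos; lra).
  assert (Hea : e <= a) by apply Rmin_l. assert (Hed : e <= d / 4) by apply Rmin_r.
  assert (Eshrink : square_integral g a = square_integral g e).
  { apply rect_integral_inner; try lra. intros x y Hx Hy Hxy.
    apply Hg; [now apply Csup_le_iff|]. intros Ez. injection Ez. intros. apply Hxy. lra. }
  rewrite Eshrink. replace (eps * 8) with (8 * e * (eps / e)) by (field; lra).
  assert (Hbd : forall z, Csup z = e -> e <= Cmod z < d).
  { intros z Hz. assert (Hlow := Csup_le_Cmod z). assert (Hup := Cmod_le_Csup z). lra. }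
  apply Cmod_square_integral_le; [exact He0 | |]; intros z Hz; specialize (Hbd z Hz).
  - apply Hg; [lra | apply Cmod_gt_0; lra].
  - specialize (Hzg z ltac:(lra)). replace (z * g z - 0)%C with (z * g z)%C in Hzg by ring.
    rewrite Cmod_mult in Hzg. assert (Hgz := Cmod_ge_0 (g z)).
    apply Rle_div_r; [exact He0|]. nra.
Qed.

Lemma is_RInt_div_sum_sqr_odd (a b : R) : b <> 0 ->
  is_RInt (fun t => t / (t ^ 2 + b ^ 2)) (-a) a 0.
Proof.
  intros Hb. assert (Hb2 := pow2_gt_0 b Hb).
  replace 0 with (minus (ln (a ^ 2 + b ^ 2) / 2) (ln ((-a) ^ 2 + b ^ 2) / 2))
    by (replace ((-a) ^ 2) with (a ^ 2) by ring; apply (minus_eq_zero (G := R_AbelianGroup))).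
  assert (Hpos : forall t, 0 < t ^ 2 + b ^ 2) by (intros t; assert (Ht2 := pow2_ge_0 t); lra).
  apply (is_RInt_derive (fun t => ln (t ^ 2 + b ^ 2) / 2)); intros t _; specialize (Hpos t).
  - auto_derive; [exact Hpos | field; lra].
  - apply (ex_derive_continuous (K := R_AbsRing) (V := R_NormedModule)).
    auto_derive. lra.
Qed.

Lemma is_RInt_div_sum_sqr_atan (a b : R) : b <> 0 ->
  is_RInt (fun t => b / (t ^ 2 + b ^ 2)) (-a) a (2 * atan (a / b)).
Proof.
  intros Hb. assert (Hb2 := pow2_gt_0 b Hb).
  replace (2 * atan (a / b)) with (minus (atan (a / b)) (atan (- a / b)))
    by (unfold minus, plus, opp; simpl; rewrite Rdiv_opp_l, atan_opp; ring).
  assert (Hpos : forall t, 0 < t ^ 2 + b ^ 2) by (intros t; assert (Ht2 := pow2_ge_0 t); lra).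
  apply (is_RInt_derive (fun t => atan (t / b))); intros t _; specialize (Hpos t).
  - auto_derive; [exact I | field; lra].
  - apply (ex_derive_continuous (K := R_AbsRing) (V := R_NormedModule)).
    auto_derive. lra.
Qed.

Lemma CInt_Cinv_horizontal (a b : R) : b <> 0 ->
  CInt (fun t => / (t, b))%C (-a) a = (0, - (2 * atan (a / b))).
Proof.
  intros Hb. apply (is_RInt_unique (V := C_R_CompleteNormedModule)).
  apply (is_RInt_fct_extend_pair (U := R_NormedModule) (V := R_NormedModule)); simpl.
  - eapply is_RInt_ext; [|now apply (is_RInt_div_sum_sqr_odd a b)].
    intros t _. reflexivity.
  - eapply is_RInt_ext;
      [|apply (is_RInt_opp (V := R_NormedModule)), (is_RInt_div_sum_sqr_atan a b Hb)].
    intros t _. unfold opp; simpl. now rewrite Rdiv_opp_l.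
Qed.

Lemma CInt_Cinv_vertical (a b : R) : b <> 0 ->
  CInt (fun t => / (b, t))%C (-a) a = (2 * atan (a / b), 0).
Proof.
  intros Hb. apply (is_RInt_unique (V := C_R_CompleteNormedModule)).
  apply (is_RInt_fct_extend_pair (U := R_NormedModule) (V := R_NormedModule)); simpl.
  - eapply is_RInt_ext; [|now apply (is_RInt_div_sum_sqr_atan a b)].
    intros t _. apply (f_equal (Rdiv b)). ring.
  - rewrite <- Ropp_0.
    eapply is_RInt_ext;
      [|apply (is_RInt_opp (V := R_NormedModule)), (is_RInt_div_sum_sqr_odd a b Hb)].
    intros t _. unfold opp; simpl. rewrite <- Rdiv_opp_l. apply (f_equal (Rdiv (- t))). ring.
Qed.

Lemma square_integral_Cinv (a : R) : 0 < a -> square_integral Cinv a = (2 * PI * Ci)%C.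
Proof.
  intros Ha. unfold square_integral, rect_integral.
  rewrite !CInt_Cinv_horizontal, !CInt_Cinv_vertical by lra.
  rewrite Rdiv_opp_r, Rdiv_diag, atan_opp, atan_1 by lra.
  apply injective_projections; simpl; field.
Qed.

Lemma square_integral_scal (c : C) (f : C -> C) (a : R) : 0 < a ->
  (forall z, Csup z = a -> Cderivable f z) ->
  square_integral (fun z => c * f z)%C a = (c * square_integral f a)%C.
Proof.
  intros Ha Hf. apply rect_integral_scal, Cderivable_rect_integrable; try lra.
  intros x y Hxy. apply Hf, Csup_boundary; [lra | exact Hxy].
Qed.

Lemma square_integral_minus (f g : C -> C) (a : R) : 0 < a ->
  (forall z, Csup z = a -> Cderivable f z) -> (forall z, Csup z = a -> Cderivable g z) ->
  square_integral (fun z => f z - g z)%C a = (square_integral f a - square_integral g a)%C.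
Proof.
  intros Ha Hf Hg. apply rect_integral_minus; apply Cderivable_rect_integrable; try lra;
    intros x y Hxy; [apply Hf | apply Hg]; (apply Csup_boundary; [lra | exact Hxy]).
Qed.

Lemma Csup_gt_0_neq_0 (z : C) : 0 < Csup z -> z <> 0.
Proof. intros Hz. apply Cmod_gt_0. assert (Hmod := Csup_le_Cmod z). lra. Qed.

Lemma Cauchy_formula (f : C -> C) (l : C) (a : R) : 0 < a ->
  (forall z, Csup z <= a -> z <> 0 -> Cderivable f z) ->
  filterlim f (nhds' 0) (nhds l) ->
  square_integral (fun z => f z / z)%C a = (2 * PI * Ci * l)%C.
Proof.
  intros Ha Hf Hl.
  assert (Hfz : forall z, Csup z <= a -> z <> 0 -> Cderivable (fun z => f z / z)%C z).
  { intros z Hz Hz0. apply Cderivable_div; [exact Hz0 | now apply Hf | apply Cderivable_id]. }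
  assert (Hinv : forall z : C, z <> 0 -> Cderivable Cinv z)
    by (intros z Hz0; eexists; now apply Cderiv_Cinv).
  assert (Hinvl : forall z : C, z <> 0 -> Cderivable (fun z => l * / z)%C z)
    by (intros z Hz0; now apply Cderivable_mult; [apply Cderivable_const | apply Hinv]).
  assert (Hne : forall z, Csup z = a -> z <> 0) by (intros z Hz; apply Csup_gt_0_neq_0; lra).
  assert (Hremovable : square_integral (fun z => f z / z - l * / z)%C a = 0).
  { apply square_integral_removable; [exact Ha | |].
    - intros z Hz Hz0. now apply Cderivable_minus; [apply Hfz | apply Hinvl].
    - apply (filterlim_ext_loc (fun z => f z - l)%C).
      + generalize (nhds'_neq 0). apply filter_imp. intros z Hz. field. exact Hz.
      + apply (Clim_eq _ (l - l)%C); [|ring]. apply Clim_minus; [exact Hl | apply Clim_const]. }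
  rewrite square_integral_minus, square_integral_scal, square_integral_Cinv
    in Hremovable by first [exact Ha | intros z Hz;
      first [apply Hfz; [lra|] | apply Hinvl | apply Hinv]; now apply Hne].
  apply Ceq_minus in Hremovable. rewrite Hremovable. ring.
Qed.

Lemma Cauchy_bound (f : C -> C) (l : C) (a M : R) : 0 < a ->
  (forall z, Csup z <= a -> z <> 0 -> Cderivable f z) ->
  filterlim f (nhds' 0) (nhds l) ->
  (forall z, Csup z = a -> Cmod (f z) <= M) ->
  Cmod l <= 2 * M.
Proof.
  intros Ha Hf Hl HM.
  assert (H : Cmod (2 * PI * Ci * l)%C <= 8 * a * (M / a)).
  { rewrite <- (Cauchy_formula f l a Ha Hf Hl).
    apply Cmod_square_integral_le; [exact Ha | |]; intros z Hz;
      assert (Hz0 : z <> 0) by (apply Csup_gt_0_neq_0; lra).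
    - apply Cderivable_div; [exact Hz0 | apply Hf; [lra | exact Hz0] | apply Cderivable_id].
    - apply Cmod_div_le; [rewrite <- Hz; split; [lra | apply Csup_le_Cmod] | now apply HM]. }
  assert (HPI := PI2_1).
  rewrite !Cmod_mult, Cmod_Ci, !Cmod_R, !Rabs_right in H by lra.
  replace (8 * a * (M / a)) with (8 * M) in H by (field; lra).
  assert (HCl := Cmod_ge_0 l). nra.
Qed.

Lemma Cauchy_estimate (f : C -> C) (c l : C) (a M : R) : 0 < a ->
  Cderiv f c l ->
  (forall z, Csup z <= a -> Cderivable f (c + z)) ->
  (forall z, Csup z <= a -> Cmod (f (c + z)%C) <= M) ->
  Cmod l <= 4 * M / a.
Proof.
  intros Ha Hl Hf HM.
  replace (4 * M / a) with (2 * (2 * M / a)) by (field; lra).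
  apply (Cauchy_bound (fun z => (f (c + z) - f c) / z)%C l a); [exact Ha | | |].
  - intros z Hz Hz0. apply Cderivable_div; [exact Hz0 | | apply Cderivable_id].
    apply Cderivable_minus; [now apply Cderivable_shift, Hf | apply Cderivable_const].
  - assert (Hg : Cderiv (fun z => f (c + z))%C 0 l).
    { eapply Cderiv_eq.
      - apply (Cderiv_comp f (fun z => c + z)%C).
        + rewrite Cplus_0_r. exact Hl.
        + apply Cderiv_plus; [apply Cderiv_const | apply Cderiv_id].
      - ring. }
    apply Cderiv_iff_lim in Hg. eapply filterlim_ext; [|exact Hg].
    intros z. simpl. rewrite Cplus_0_r. now replace (z - 0)%C with z by ring.
  - intros z Hz. assert (Hmod := Csup_le_Cmod z).
    assert (HMc := HM 0 ltac:(apply Csup_le_iff; lra)). rewrite Cplus_0_r in HMc.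
    assert (HMz := HM z ltac:(lra)).
    apply Cmod_div_le; [lra|].
    assert (Htri := Cmod_minus_le (f (c + z)%C) (f c)). lra.
Qed.

(** * Identity theorem *)

Lemma Cderivable_bounded_on_square (f : C -> C) (c : C) (a : R) : 0 < a ->
  (forall z, Csup z <= a -> Cderivable f (c + z)) ->
  exists M, forall z, Csup z <= a -> Cmod (f (c + z)%C) <= M.
Proof.
  intros Ha Hf.
  cut (exists M, forall x y, -a <= x <= a -> -a <= y <= a -> Cmod (f (c + (x, y))%C) <= M).
  { intros [M HM]. exists M. intros [x y] Hz. apply Csup_le_iff in Hz. now apply HM. }
  refine (rectangle_induction (fun u v s t => -a <= u /\ v <= a -> -a <= s /\ t <= a ->
    exists M, forall x y, u <= x <= v -> s <= y <= t -> Cmod (f (c + (x, y))%C) <= M)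
    (-a) a (-a) a _ _ _ _ _ _); try lra.
  - intros u v s t Huv Hst m n Hbl Hbr Htl Htr Hx Hy.
    assert (Hm : u <= m <= v) by (unfold m; lra). assert (Hn : s <= n <= t) by (unfold n; lra).
    destruct Hbl as [Mbl Hbl], Hbr as [Mbr Hbr], Htl as [Mtl Htl], Htr as [Mtr Htr]; try lra.
    exists (Rmax (Rmax Mbl Mbr) (Rmax Mtl Mtr)). intros x y Hxv Hyt. rewrite !Rmax_Rle.
    destruct (Rle_or_lt x m), (Rle_or_lt y n);
      [left; left; apply Hbl | right; left; apply Htl | left; right; apply Hbr
      | right; right; apply Htr]; lra.
  - intros x y Hx Hy.
    assert (Hc := Hf (x, y) (proj2 (Csup_le_iff x y a) (conj Hx Hy))).
    apply Cderivable_continuous in Hc. rewrite filterlim_nhds in Hc by typeclasses eauto.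
    destruct (proj1 (nhds_iff _ _) (Hc 1 Rlt_0_1)) as [d [Hd Hfd]].
    exists (d / 2). split; [lra|]. intros u v s t Hux Hsy Hw Hh _ _.
    exists (Cmod (f (c + (x, y))%C) + 1). intros x' y' Hx' Hy'.
    specialize (Hfd (c + (x', y'))%C).
    replace (c + (x', y') - (c + (x, y)))%C with ((x', y') - (x, y))%C in Hfd by ring.
    assert (Hdist := Cmod_pair_sub_le x' y' x y).
    assert (Rabs (x' - x) < d / 2) by (apply Rabs_def1; lra).
    assert (Rabs (y' - y) < d / 2) by (apply Rabs_def1; lra).
    specialize (Hfd ltac:(lra)).
    assert (Htri := Cmod_le_minus (f (c + (x', y'))%C) (f (c + (x, y))%C)). lra.
Qed.

Lemma Cmod_center_le (f : C -> C) (c : C) (a M : R) : 0 < a ->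
  (forall z, Csup z <= a -> Cderivable f (c + z)) ->
  (forall z, Csup z = a -> Cmod (f (c + z)%C) <= M) ->
  Cmod (f c) <= 2 * M.
Proof.
  intros Ha Hf HM.
  apply (Cauchy_bound (fun z => f (c + z)%C) (f c) a); try assumption.
  - intros z Hz _. now apply Cderivable_shift, Hf.
  - apply (Clim_eq _ (f (c + 0)%C)); [|now rewrite Cplus_0_r].
    apply (Cderivable_lim (fun z => f (c + z)%C)), Cderivable_shift, Hf. apply Csup_le_iff. lra.
Qed.

(* Multiplying [F] by [(z0 - c) / (z - c)] keeps its value at [z0] and halves its
   bound on the boundary of the square. *)
Lemma Cmod_center_le_of_vanishing (z0 c : C) (a : R) (m : nat) (F : C -> C) (M : R) :
  0 < a -> z0 <> c -> 3 * Cmod (z0 - c) <= a ->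
  (forall z, Csup z <= a -> Cderivable F (z0 + z)) ->
  nhds c (fun z => F z = 0) ->
  (forall z, Csup z = a -> Cmod (F (z0 + z)%C) <= M) ->
  Cmod (F z0) <= 2 * M / 2 ^ m.
Proof.
  intros Ha Hne Hac. apply Cminus_eq_contra in Hne.
  revert F M. induction m as [|m IH]; intros F M Hd Hv HM.
  - replace (2 * M / 2 ^ 0) with (2 * M) by (simpl; field).
    now apply (Cmod_center_le F z0 a).
  - set (G := fun z => (F z * ((z0 - c) / (z - c)))%C).
    replace (F z0) with (G z0) by (unfold G; field; exact Hne).
    replace (2 * M / 2 ^ S m) with (2 * (M / 2) / 2 ^ m)
      by (simpl; field; apply pow_nonzero; lra).
    apply IH.
    + intros z Hz. destruct (Ceq_dec (z0 + z) c) as [Ec|Ec].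
      * exists 0. rewrite Ec. apply (Cderiv_ext_loc (fun _ => 0)); [|apply Cderiv_const].
        revert Hv. apply filter_imp. intros y Hy. unfold G. rewrite Hy. ring.
      * apply Cderivable_mult; [now apply Hd|].
        apply Cderivable_div; [now apply Cminus_eq_contra | apply Cderivable_const |].
        apply Cderivable_minus; [apply Cderivable_id | apply Cderivable_const].
    + revert Hv. apply filter_imp. intros y Hy. unfold G. rewrite Hy. ring.
    + intros z Hz.
      assert (Hmod := Csup_le_Cmod z). assert (Hk := proj1 (Cmod_gt_0 _) Hne).
      assert (Htri := Cmod_minus_le (z0 + z - c) (z0 - c)).
      replace (z0 + z - c - (z0 - c))%C with z in Htri by ring.
      assert (Hfar : 2 * Cmod (z0 - c) <= Cmod (z0 + z - c)) by lra.
      unfold G. rewrite Cmod_mult, Cmod_div by (apply Cmod_gt_0; lra).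
      apply Rmult_le_compat; [apply Cmod_ge_0 | | now apply HM |].
      * apply Rdiv_le_0_compat; lra.
      * apply Rle_div_l; lra.
Qed.

Lemma vanishing_spread (F : C -> C) (c : C) (r : R) :
  (forall z, Cmod (z - c) < r -> Cderivable F z) ->
  nhds c (fun z => F z = 0) ->
  forall z, Cmod (z - c) < r / 8 -> F z = 0.
Proof.
  intros Hd Hv z Hz.
  destruct (Ceq_dec z c) as [->|Hne]; [exact (nhds_singleton c _ Hv)|].
  assert (Hzc := Cmod_ge_0 (z - c)).
  set (a := 3 * r / 8).
  assert (Ha : 0 < a) by (unfold a; lra).
  assert (Hda : forall xi, Csup xi <= a -> Cderivable F (z + xi)).
  { intros xi Hxi. apply Hd. assert (Hmod := Cmod_le_Csup xi).
    replace (z + xi - c)%C with ((z - c) + xi)%C by ring.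
    eapply Rle_lt_trans; [apply Cmod_triangle|]. unfold a in *. lra. }
  destruct (Cderivable_bounded_on_square F z a Ha Hda) as [M HM].
  apply Cmod_eq_0, Rle_antisym; [|apply Cmod_ge_0].
  apply (is_lim_seq_le (fun _ => Cmod (F z)) (fun m => 2 * M / 2 ^ m) (Cmod (F z)) 0).
  - intros m. apply (Cmod_center_le_of_vanishing z c a); try assumption; [unfold a; lra|].
    intros xi Hxi. apply HM. lra.
  - apply is_lim_seq_const.
  - apply is_lim_seq_halving.
Qed.

Lemma identity_theorem_disc (F : C -> C) (r : R) :
  (forall z, Cmod z < r -> Cderivable F z) ->
  nhds 0 (fun z => F z = 0) ->
  forall z, Cmod z < r -> F z = 0.
Proof.
  intros Hd Hv z Hz.
  set (s := r - Cmod z).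
  assert (Hz0 := Cmod_ge_0 z).
  destruct (INR_archimed (s / 8) (Cmod z)) as [N HN]; [unfold s; lra|].
  assert (HN0 : 0 < INR N) by (unfold s in HN; nra).
  assert (Hstep : Cmod z / INR N < s / 8) by (apply Rlt_div_l; lra).
  set (c := fun k => (RtoC (INR k / INR N) * z)%C).
  assert (Hc : forall k, (k <= N)%nat -> nhds (c k) (fun y => F y = 0)).
  { induction k as [|k IH]; intros Hk.
    - replace (c O) with (RtoC 0); [exact Hv|].
      unfold c. simpl. rewrite Rdiv_0_l. ring.
    - assert (Hnext : Cmod (c (S k) - c k) < s / 8).
      { unfold c. rewrite S_INR.
        replace (RtoC ((INR k + 1) / INR N) * z - RtoC (INR k / INR N) * z)%C
          with (RtoC (/ INR N) * z)%C by (rewrite Rdiv_plus_distr, RtoC_plus, Rdiv_1_l; ring).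
        rewrite Cmod_mult, Cmod_R, Rabs_inv, Rabs_right by lra. lra. }
      assert (Hck : Cmod (c k) <= Cmod z).
      { unfold c. rewrite Cmod_mult, Cmod_R.
        assert (HkN : INR k <= INR N) by (apply le_INR; lia).
        assert (Hk0 := pos_INR k).
        assert (0 <= INR k / INR N) by (apply Rdiv_le_0_compat; lra).
        assert (INR k / INR N <= 1) by (apply Rle_div_l; lra).
        rewrite Rabs_right by lra. nra. }
      apply nhds_iff. exists (s / 8 - Cmod (c (S k) - c k)). split; [lra|].
      intros y Hy. apply (vanishing_spread F (c k) s); [|apply IH; lia|].
      + intros x Hx. apply Hd.
        assert (Htri := Cmod_le_minus x (c k)). unfold s in Hx. lra.
      + assert (Htri := Cmod_minus_trans y (c (S k)) (c k)). lra. }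
  replace z with (c N) by (unfold c; rewrite Rdiv_diag by lra; ring).
  exact (nhds_singleton (c N) _ (Hc N (le_n N))).
Qed.

(** * A singular Gronwall inequality *)

(* [f t / t ^ k] is nonincreasing and tends to [0] at [0]. *)
Lemma singular_gronwall_real (f df : R -> R) (k : nat) (K : R) :
  (forall t, 0 < t <= 1 -> is_derive f t (df t)) ->
  (forall t, 0 < t <= 1 -> t * df t <= INR k * f t) ->
  (forall t, 0 < t <= 1 -> f t <= K * t ^ S k) ->
  f 1 <= 0.
Proof.
  intros Hd Hg HK.
  set (phi := fun t => f t / t ^ k). set (dphi := fun t => (t * df t - INR k * f t) / t ^ S k).
  assert (Hphi : forall t, 0 < t <= 1 -> is_derive phi t (dphi t)).
  { intros t Ht. assert (Htk : t ^ k <> 0) by (apply pow_nonzero; lra).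
    assert (H := is_derive_div f (fun t => t ^ k) t _ _ (Hd t Ht)
      (is_derive_pow _ k t _ (is_derive_id (K := R_AbsRing) t)) Htk).
    replace (dphi t) with ((df t * t ^ k - f t * (INR k * one * t ^ pred k)) / (t ^ k) ^ 2);
      [exact H|].
    unfold dphi, one; simpl. destruct k as [|k]; simpl in *; field; [lra|].
    split; [|lra]. apply pow_nonzero; lra. }
  assert (Hdec : forall s, 0 < s <= 1 -> phi 1 <= phi s).
  { intros s Hs.
    destruct (MVT_gen phi s 1 dphi) as [x [Hx Emvt]].
    - rewrite Rmin_left, Rmax_right by lra. intros t Ht. apply Hphi; lra.
    - rewrite Rmin_left, Rmax_right by lra. intros t Ht.
      apply continuity_pt_filterlim,
        (ex_derive_continuous (K := R_AbsRing) (V := R_NormedModule) phi).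
      exists (dphi t). apply Hphi; lra.
    - rewrite Rmin_left, Rmax_right in Hx by lra.
      assert (Hle : dphi x <= 0).
      { unfold dphi. apply Rle_div_l; [apply pow_lt; lra|]. specialize (Hg x ltac:(lra)). lra. }
      nra. }
  apply (Rle_0_of_le_eps_mult _ K). intros s Hs.
  replace (f 1) with (phi 1) by (unfold phi; rewrite pow1; field).
  eapply Rle_trans; [now apply Hdec|]. unfold phi.
  apply Rle_div_l; [apply pow_lt; lra|].
  replace (s * K * s ^ k) with (K * s ^ S k) by (simpl; ring). now apply HK.
Qed.

Lemma is_derive_Cmod2 (g : R -> C) (t : R) (l : C) :
  is_derive (K := R_AbsRing) (V := C_R_NormedModule) g t l ->
  is_derive (fun s => Cmod (g s) ^ 2) t (2 * Re (Cconj (g t) * l)%C).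
Proof.
  intros H.
  assert (HRe : is_derive (fun s => Re (g s)) t (Re l))
    by exact (filterdiff_comp' (V := C_R_NormedModule) g fst t _ _ H
      (filterdiff_linear (U := C_R_NormedModule) (V := R_NormedModule) fst is_linear_fst)).
  assert (HIm : is_derive (fun s => Im (g s)) t (Im l))
    by exact (filterdiff_comp' (V := C_R_NormedModule) g snd t _ _ H
      (filterdiff_linear (U := C_R_NormedModule) (V := R_NormedModule) snd is_linear_snd)).
  apply (is_derive_ext (fun s => Re (g s) ^ 2 + Im (g s) ^ 2)); [intros s; now rewrite Cmod2_alt|].
  replace (2 * Re (Cconj (g t) * l)%C)
    with (INR 2 * Re l * Re (g t) ^ 1 + INR 2 * Im l * Im (g t) ^ 1)
    by (unfold Re, Im; simpl; ring).
  apply (is_derive_plus (fun s => Re (g s) ^ 2) (fun s => Im (g s) ^ 2)); now apply is_derive_pow.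
Qed.

Lemma Rle_pow_le_1 (x : R) (m n : nat) : 0 <= x <= 1 -> (m <= n)%nat -> x ^ n <= x ^ m.
Proof.
  intros Hx. induction 1 as [|n _ IH]; [lra|].
  simpl. assert (H := pow_le x n (proj1 Hx)). nra.
Qed.

Lemma singular_gronwall (D dD : C -> C) (r M : R) (k n : nat) : (k < 2 * n)%nat ->
  (forall z, 0 < Cmod z < r -> Cderiv D z (dD z)) ->
  (forall z, 0 < Cmod z < r -> 2 * (Cmod z * Cmod (dD z)) <= INR k * Cmod (D z)) ->
  (forall z, 0 < Cmod z < r -> Cmod (D z) <= M * Cmod z ^ n) ->
  forall z, 0 < Cmod z < r -> D z = 0.
Proof.
  intros Hkn Hd Hg HM z Hz.
  assert (Hray : forall t, 0 < t <= 1 -> Cmod (t * z) = t * Cmod z /\ 0 < Cmod (t * z) < r).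
  { intros t Ht. rewrite Cmod_mult, Cmod_R, Rabs_right by lra. nra. }
  assert (H : Cmod (D (1 * z)%C) ^ 2 <= 0).
  { apply (singular_gronwall_real (fun t => Cmod (D (t * z)%C) ^ 2)
      (fun t => 2 * Re (Cconj (D (t * z)%C) * (z * dD (t * z)%C))%C)
      k (M ^ 2 * Cmod z ^ (2 * n))); intros t Ht; destruct (Hray t Ht) as [Et Htr].
    - apply (is_derive_Cmod2 (fun t => D (t * z)%C)).
      apply (is_derive_ext (fun s : R => D (0 + s * z)%C)); [intros s; now rewrite Cplus_0_l|].
      apply Cderiv_along_line. rewrite Cplus_0_l. now apply Hd.
    - specialize (Hg _ Htr). rewrite Et in Hg. assert (HD := Cmod_ge_0 (D (t * z)%C)).
      assert (HRe : Re (Cconj (D (t * z)) * (z * dD (t * z)))%C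
        <= Cmod (D (t * z)%C) * (Cmod z * Cmod (dD (t * z)%C))).
      { rewrite <- (Cmod_conj (D _)), <- !Cmod_mult.
        eapply Rle_trans; [apply Rle_abs | apply re_le_Cmod]. }
      nra.
    - specialize (HM _ Htr). rewrite Et in HM.
      apply Rle_trans with ((M * (t * Cmod z) ^ n) ^ 2).
      + apply pow_incr. split; [apply Cmod_ge_0 | exact HM].
      + replace ((M * (t * Cmod z) ^ n) ^ 2) with (M ^ 2 * Cmod z ^ (2 * n) * t ^ (2 * n))
          by (rewrite !(Nat.mul_comm 2), !pow_mult, !Rpow_mult_distr; ring).
        apply Rmult_le_compat_l.
        * apply Rmult_le_pos; [apply pow2_ge_0 | apply pow_le, Cmod_ge_0].
        * apply Rle_pow_le_1; [lra | lia]. }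
  replace (1 * z)%C with z in H by ring.
  apply Cmod_eq_0. assert (HDz := Cmod_ge_0 (D z)). nra.
Qed.

(** * Double zeros of solutions of [(U')^2 = Q(U)] *)

Lemma Cderiv_pow (z : C) (n : nat) : Cderiv (fun x => x ^ S n)%C z (INR (S n) * z ^ n)%C.
Proof.
  induction n as [|n IH].
  - eapply Cderiv_eq; [apply Cderiv_mult; [apply Cderiv_id | apply Cderiv_const]|].
    simpl. ring.
  - eapply Cderiv_eq.
    { apply (Cderiv_mult (fun x => x) (fun x => x ^ S n)%C); [apply Cderiv_id | exact IH]. }
    rewrite (S_INR (S n)), RtoC_plus. simpl. ring.
Qed.

Lemma Cderiv_lim_div_pow_0 (g dg : C -> C) (n : nat) :
  nhds' 0 (fun z => Cderiv g z (dg z)) ->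
  filterlim (fun z => g z / z ^ S n)%C (nhds' 0) (nhds 0) ->
  filterlim (fun z => dg z / z ^ n)%C (nhds' 0) (nhds 0).
Proof.
  intros Hd Hg. apply filterlim_nhds; [typeclasses eauto|]. intros eps He.
  rewrite filterlim_nhds in Hg by typeclasses eauto.
  set (e := eps / (32 * 2 ^ S n)).
  assert (H2n : 0 < 2 ^ S n) by (apply pow_lt; lra).
  assert (He' : 0 < e) by (apply Rdiv_lt_0_compat; lra).
  assert (Ee : e * (32 * 2 ^ S n) = eps) by (unfold e; field; lra). clearbody e.
  destruct (proj1 (nhds'_0_iff _) (filter_and _ _ Hd (Hg e He'))) as [d [Hd0 H]].
  apply nhds'_0_iff. exists (d / 2). split; [lra|]. intros z Hz.
  set (a := Cmod z / 4).
  assert (Hball : forall xi, Csup xi <= a -> Cmod z / 2 <= Cmod (z + xi) <= 2 * Cmod z).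
  { intros xi Hxi. assert (Hmod := Cmod_le_Csup xi). unfold a in Hxi.
    assert (Hup := Cmod_triangle z xi). assert (Hlow := Cmod_minus_le (z + xi) xi).
    replace (z + xi - xi)%C with z in Hlow by ring. lra. }
  assert (Hpow : forall y, 0 < Cmod y -> 0 < Cmod y ^ S n) by (intros; now apply pow_lt).
  assert (Hbound : Cmod (dg z) <= 4 * (e * (2 * Cmod z) ^ S n) / a).
  { apply (Cauchy_estimate g z); [unfold a; lra | apply H; lra | |]; intros xi Hxi;
      specialize (Hball xi Hxi); destruct (H (z + xi)%C ltac:(lra)) as [Hdxi Hgxi].
    - eexists. exact Hdxi.
    - assert (Hxi0 : 0 < Cmod (z + xi)) by lra.
      replace (g (z + xi) / (z + xi) ^ S n - 0)%C
        with (g (z + xi) / (z + xi) ^ S n)%C in Hgxi by ring.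
      rewrite Cmod_div, Cmod_pow in Hgxi by now apply Cpow_nz, Cmod_gt_0.
      apply Rlt_div_l in Hgxi; [|now apply Hpow].
      eapply Rle_trans; [left; exact Hgxi|]. apply Rmult_le_compat_l; [lra|].
      apply pow_incr. lra. }
  replace (dg z / z ^ n - 0)%C with (dg z / z ^ n)%C by ring.
  assert (Hzn : 0 < Cmod z ^ n) by (apply pow_lt; lra).
  rewrite Cmod_div, Cmod_pow by (apply Cpow_nz, Cmod_gt_0; lra).
  apply Rlt_div_l; [exact Hzn|].
  replace (4 * (e * (2 * Cmod z) ^ S n) / a) with (e * (32 * 2 ^ S n) / 2 * Cmod z ^ n) in Hbound
    by (unfold a; rewrite Rpow_mult_distr; simpl; field; lra).
  nra.
Qed.

Lemma Cderiv_lim_div_pow (U dU : C -> C) (m : C) (n : nat) :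
  nhds' 0 (fun z => Cderiv U z (dU z)) ->
  filterlim (fun z => U z / z ^ S n)%C (nhds' 0) (nhds m) ->
  filterlim (fun z => dU z / z ^ n)%C (nhds' 0) (nhds (INR (S n) * m)%C).
Proof.
  intros Hd HU.
  set (dg := fun z => (dU z - m * (INR (S n) * z ^ n))%C).
  assert (Hg : filterlim (fun z => dg z / z ^ n)%C (nhds' 0) (nhds 0)).
  { apply (Cderiv_lim_div_pow_0 (fun z => U z - m * z ^ S n)%C).
    - revert Hd. apply filter_imp. intros z Hz. eapply Cderiv_eq.
      + apply Cderiv_minus; [exact Hz|].
        apply (Cderiv_mult (fun _ => m)); [apply Cderiv_const | apply Cderiv_pow].
      + unfold dg. ring.
    - apply (filterlim_ext_loc (fun z => U z / z ^ S n - m)%C).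
      + generalize (nhds'_neq 0). apply filter_imp. intros z Hz. field. now apply Cpow_nz.
      + apply (Clim_eq _ (m - m)%C); [|ring]. apply Clim_minus; [exact HU | apply Clim_const]. }
  apply (filterlim_ext_loc (fun z => dg z / z ^ n + INR (S n) * m)%C).
  - generalize (nhds'_neq 0). apply filter_imp. intros z Hz. unfold dg. field. now apply Cpow_nz.
  - apply (Clim_eq _ (0 + INR (S n) * m)%C); [|ring].
    apply Clim_plus; [exact Hg | apply Clim_const].
Qed.

Definition double_zero_solution (Q : C -> C) (m : C) (U dU : C -> C) : Prop :=
  nhds' 0 (fun z => Cderiv U z (dU z) /\ (dU z * dU z)%C = Q (U z)) /\
  filterlim (fun z => U z / z ^ 2)%C (nhds' 0) (nhds m).

Lemma double_zero_solution_lim (Q : C -> C) (m : C) (U dU : C -> C) :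
  double_zero_solution Q m U dU ->
  filterlim U (nhds' 0) (nhds 0) /\ filterlim (fun z => dU z / z)%C (nhds' 0) (nhds (2 * m)%C).
Proof.
  intros [Hd HU]. split.
  - apply (filterlim_ext_loc (fun z => U z / z ^ 2 * (z * z))%C).
    + generalize (nhds'_neq 0). apply filter_imp. intros z Hz. field. exact Hz.
    + apply (Clim_eq _ (m * (0 * 0))%C); [|ring]. repeat apply Clim_mult; auto using Clim_id.
  - assert (H := Cderiv_lim_div_pow U dU m 1). simpl INR in H.
    replace (RtoC (1 + 1)) with (RtoC 2) in H by (f_equal; ring).
    eapply filterlim_ext; [|apply H; [|exact HU]].
    + intros z. simpl. now rewrite Cmult_1_r.
    + revert Hd. now apply filter_imp.
Qed.

Lemma Cmod_ratio_le (x y s t c : C) : c <> 0 -> (x * s = y * t)%C ->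
  Cmod (s - c) < Cmod c / 8 -> Cmod (t - c) < Cmod c / 8 ->
  7 * Cmod x <= 9 * Cmod y.
Proof.
  intros Hc E Hs Ht. apply Cmod_gt_0 in Hc.
  apply (f_equal Cmod) in E. rewrite !Cmod_mult in E.
  assert (Hmod_t := Cmod_le_minus t c).
  assert (Hmod_s := Cmod_le_minus c s). rewrite Cmod_minus_sym in Hmod_s.
  assert (Hx := Cmod_ge_0 x). assert (Hy := Cmod_ge_0 y).
  apply (Rmult_le_reg_r (Cmod c / 8)); [lra|].
  assert (Cmod x * (7 * Cmod c / 8) <= Cmod x * Cmod s) by (apply Rmult_le_compat_l; lra).
  assert (Cmod y * Cmod t <= Cmod y * (9 * Cmod c / 8)) by (apply Rmult_le_compat_l; lra).
  lra.
Qed.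

(* The difference [D = U - V] of two solutions satisfies [D' (U' + V') = D * slope U V], where
   [U' + V' ~ 4 m z] and [slope U V ~ 4 m], so [D' ~ D / z], while [D = o(z^2)]. *)
Lemma double_zero_solution_unique (Q : C -> C) (slope : C -> C -> C) (m : C) (U dU V dV : C -> C) :
  m <> 0 ->
  (forall u v, Q u - Q v = (u - v) * slope u v)%C ->
  filterlim (fun p => slope (fst p) (snd p)) (filter_prod (nhds 0) (nhds 0)) (nhds (4 * m)%C) ->
  double_zero_solution Q m U dU -> double_zero_solution Q m V dV ->
  nhds' 0 (fun z => U z = V z).
Proof.
  intros Hm HQ Hslope HU HV.
  destruct (double_zero_solution_lim _ _ _ _ HU) as [HU0 HdU].
  destruct (double_zero_solution_lim _ _ _ _ HV) as [HV0 HdV].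
  destruct HU as [HU HU2], HV as [HV HV2].
  assert (HS := filterlim_comp_2 U V slope HU0 HV0 Hslope).
  assert (HT := Clim_plus _ _ _ _ HdU HdV).
  assert (HD := Clim_minus _ _ _ _ HU2 HV2).
  rewrite filterlim_nhds in HS, HT, HD by typeclasses eauto.
  assert (Hm4 : (4 * m)%C <> 0) by (apply Cmult_neq_0; [apply RtoC_neq; lra | exact Hm]).
  assert (Hmpos : 0 < Cmod (4 * m) / 8) by (apply Rdiv_lt_0_compat; [now apply Cmod_gt_0 | lra]).
  specialize (HS _ Hmpos). specialize (HT _ Hmpos).
  specialize (HD 1 Rlt_0_1).
  destruct (proj1 (nhds'_0_iff _) (filter_and _ _ (filter_and _ _ HU HV)
    (filter_and _ _ HD (filter_and _ _ HS HT)))) as [d [Hd H]].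
  apply nhds'_0_iff. exists d. split; [exact Hd|].
  cut (forall z, 0 < Cmod z < d -> (U z - V z)%C = 0).
  { intros HUV z Hz. now apply Ceq_minus, HUV. }
  apply (singular_gronwall (fun z => U z - V z)%C (fun z => dU z - dV z)%C d 1 3 2); [lia | | |];
    intros z Hz; assert (Hz0 : z <> 0) by (apply Cmod_gt_0; lra);
    destruct (H z Hz) as [[[HUz HQU] [HVz HQV]] [HDz [HSz HTz]]].
  - now apply Cderiv_minus.
  - assert (Esing : (z * (dU z - dV z) * (dU z / z + dV z / z) = (U z - V z) * slope (U z) (V z))%C)
      by (rewrite <- HQ, <- HQU, <- HQV; field; exact Hz0).
    replace (2 * m + 2 * m)%C with (4 * m)%C in HTz by ring.
    assert (Hratio := Cmod_ratio_le _ _ _ _ _ Hm4 Esing HTz HSz). rewrite Cmod_mult in Hratio.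
    assert (HUV := Cmod_ge_0 (U z - V z)). simpl INR. lra.
  - replace (U z - V z)%C with ((U z / z ^ 2 - V z / z ^ 2 - (m - m)) * z ^ 2)%C
      by (field; exact Hz0).
    rewrite Cmod_mult, Cmod_pow.
    apply Rmult_le_compat_r; [apply pow_le, Cmod_ge_0 | lra].
Qed.

(** * The quartic satisfied by [w^2] and [2 A / (6 - P)] *)

Open Scope C_scope.

Definition quartic (A u : C) : C := 4 * u * (32 * u ^ 3 - 48 * u ^ 2 + 18 * u - 2 * A).

Definition quartic_slope (A u v : C) : C :=
  128 * (u * u * u + u * u * v + (u * v * v + v * v * v))
  - 192 * (u * u + u * v + v * v) + (72 * (u + v) - 8 * A).

Lemma quartic_sub (A u v : C) : quartic A u - quartic A v = (u - v) * quartic_slope A u v.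
Proof. unfold quartic, quartic_slope. ring. Qed.

Lemma quartic_slope_lim (A : C) :
  filterlim (fun p => quartic_slope A (fst p) (snd p)) (filter_prod (nhds 0) (nhds 0))
    (nhds (4 * (-2 * A))).
Proof.
  assert (Hfst : filterlim fst (filter_prod (nhds 0) (nhds 0)) (nhds 0)) by exact filterlim_fst.
  assert (Hsnd : filterlim snd (filter_prod (nhds 0) (nhds 0)) (nhds 0)) by exact filterlim_snd.
  unfold quartic_slope. eapply Clim_eq.
  - repeat first [apply Clim_minus | apply Clim_plus | apply Clim_const | apply Clim_mult
                 | exact Hfst | exact Hsnd].
  - ring.
Qed.

Lemma T6_expand (x : C) : T6 x = 32 * x ^ 6 - 48 * x ^ 4 + 18 * x ^ 2 - 1.
Proof. unfold T6, chebT. simpl. ring. Qed.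

Lemma quartic_T6 (A w : C) : quartic A (w ^ 2) = 4 * w ^ 2 * (T6 w - (2 * A - 1)).
Proof. rewrite T6_expand. unfold quartic. ring. Qed.

Lemma square_double_zero_solution (A : C) (w dw : C -> C) (r : R) : (0 < r)%R ->
  (forall z, Cmod z < r -> Cderiv w z (dw z) /\ dw z * dw z = T6 (w z) - (2 * A - 1)) ->
  w 0 = 0 ->
  double_zero_solution (quartic A) (-2 * A) (fun z => w z ^ 2) (fun z => 2 * w z * dw z).
Proof.
  intros Hr Hw Hw0. destruct (Hw 0) as [Hdw0 Hode0]; [now rewrite Cmod_0|]. split.
  - apply nhds'_0_iff. exists r. split; [exact Hr|]. intros z [_ Hz].
    destruct (Hw z Hz) as [Hdw Hode]. split.
    + eapply Cderiv_eq; [apply (Cderiv_comp (fun x => x ^ 2) w); [apply Cderiv_pow | exact Hdw]|].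
      simpl INR. rewrite RtoC_plus. ring.
    + rewrite quartic_T6, <- Hode. ring.
  - apply Cderiv_iff_lim in Hdw0.
    apply (filterlim_ext_loc (fun z => (w z - w 0) / (z - 0) * ((w z - w 0) / (z - 0)))).
    + generalize (nhds'_neq 0). apply filter_imp. intros z Hz. rewrite Hw0. field. exact Hz.
    + apply (Clim_eq _ (dw 0 * dw 0)); [now apply Clim_mult|].
      rewrite Hode0, Hw0, T6_expand. ring.
Qed.

Section Weierstrass.

Context {g2 g3 : C} {rho : R} {P dP : C -> C}.
Hypothesis Hrho : (0 < rho)%R.
Hypothesis HP : weierstrass_local g2 g3 rho P dP.

Lemma weierstrass_pole_cleared (e : C) : exists B : C -> C,
  (forall z, Cmod z < rho -> Cderivable B z) /\ B 0 = -1 /\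
  forall z, 0 < Cmod z < rho -> z ^ 2 * (e - P z) = B z.
Proof.
  destruct HP as [_ (h & dh & Hh & HPh)].
  exists (fun z => z * z * (e - h z) - 1). repeat split.
  - intros z Hz. apply Cderivable_minus; [|apply Cderivable_const].
    apply Cderivable_mult; [apply Cderivable_mult; apply Cderivable_id|].
    apply Cderivable_minus; [apply Cderivable_const | eexists; now apply Hh].
  - ring.
  - intros z Hz. rewrite HPh by exact Hz. field. apply Cmod_gt_0. lra.
Qed.

Lemma weierstrass_pole_lim (e : C) :
  filterlim (fun z => z ^ 2 * (e - P z)) (nhds' 0) (nhds (-1)).
Proof.
  destruct (weierstrass_pole_cleared e) as (B & HB & HB0 & HBP).
  apply (filterlim_ext_loc B).
  - apply nhds'_0_iff. exists rho. split; [exact Hrho|]. intros z Hz. now rewrite HBP.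
  - rewrite <- HB0. apply Cderivable_lim, HB. now rewrite Cmod_0.
Qed.

Lemma weierstrass_neq_const (e : C) : nhds' 0 (fun z => e - P z <> 0).
Proof.
  assert (Hpole := weierstrass_pole_lim e).
  rewrite filterlim_nhds in Hpole by typeclasses eauto.
  generalize (Hpole 1%R Rlt_0_1). apply filter_imp. intros z Hz E6P. revert Hz. rewrite E6P.
  replace (z ^ 2 * 0 - -1) with (RtoC 1) by ring. rewrite Cmod_1. lra.
Qed.

End Weierstrass.

Lemma quartic_weierstrass (A P dP : C) : 6 - P <> 0 ->
  dP * dP = 4 * P * P * P - 48 * (9 - 8 * A) * P - 64 * (36 * A - 27 - 8 * A ^ 2) ->
  quartic A (2 * A / (6 - P)) = (2 * A * dP / ((6 - P) * (6 - P))) ^ 2.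
Proof.
  intros Hy H.
  replace ((2 * A * dP / ((6 - P) * (6 - P))) ^ 2)
    with (4 * A ^ 2 * (dP * dP) / (6 - P) ^ 4) by (field; exact Hy).
  rewrite H. unfold quartic. field. exact Hy.
Qed.

Lemma weierstrass_double_zero_solution (A : C) (rho : R) (P dP : C -> C) : (0 < rho)%R ->
  weierstrass_local (48 * (9 - 8 * A)) (64 * (36 * A - 27 - 8 * A ^ 2)) rho P dP ->
  double_zero_solution (quartic A) (-2 * A)
    (fun z => 2 * A / (6 - P z)) (fun z => 2 * A * dP z / ((6 - P z) * (6 - P z))).
Proof.
  intros Hrho HP. assert (H6P := weierstrass_neq_const Hrho HP 6). split.
  - assert (HP' : nhds' 0 (fun z => 0 < Cmod z < rho)).
    { apply nhds'_0_iff. now exists rho. }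
    generalize (filter_and _ _ H6P HP'). apply filter_imp. intros z [Hz6 Hz].
    destruct (proj1 HP z Hz) as [HdP Hode]. split.
    + eapply Cderiv_eq.
      * apply Cderiv_mult; [apply Cderiv_const|].
        apply (Cderiv_inv (fun z => 6 - P z)); [exact Hz6|].
        apply Cderiv_minus; [apply Cderiv_const | exact HdP].
      * simpl. field. exact Hz6.
    + rewrite quartic_weierstrass with (dP := dP z) by assumption. ring.
  - apply (filterlim_ext_loc (fun z => 2 * A * / (z ^ 2 * (6 - P z)))).
    + generalize (filter_and _ _ H6P (nhds'_neq 0)). apply filter_imp.
      intros z [Hz6 Hz]. field. now split.
    + apply (Clim_eq _ (2 * A * / -1)); [|field].
      apply Clim_mult; [apply Clim_const|]. apply Clim_inv.
      * apply RtoC_neq. lra.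
      * exact (weierstrass_pole_lim Hrho HP 6).
Qed.

Section SquareAndWeierstrass.

Variables (A : C) (w dw : C -> C) (r : R) (P dP : C -> C) (rho : R).
Hypotheses (HA : A <> 0) (Hr : (0 < r)%R) (Hrho : (0 < rho)%R).
Hypothesis Hw : forall z, Cmod z < r ->
  Cderiv w z (dw z) /\ dw z * dw z = T6 (w z) - (2 * A - 1).
Hypothesis Hw0 : w 0 = 0.
Hypothesis HP : weierstrass_local (48 * (9 - 8 * A)) (64 * (36 * A - 27 - 8 * A ^ 2)) rho P dP.

Lemma square_mul_weierstrass_near_0 : nhds' 0 (fun z => w z ^ 2 * (6 - P z) = 2 * A).
Proof.
  assert (Heq : nhds' 0 (fun z => w z ^ 2 = 2 * A / (6 - P z))).
  { apply (double_zero_solution_unique (quartic A) (quartic_slope A) (-2 * A)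
      (fun z => w z ^ 2) (fun z => 2 * w z * dw z)
      (fun z => 2 * A / (6 - P z)) (fun z => 2 * A * dP z / ((6 - P z) * (6 - P z)))).
    - apply Cmult_neq_0; [apply RtoC_neq; lra | exact HA].
    - apply quartic_sub.
    - apply quartic_slope_lim.
    - now apply (square_double_zero_solution A w dw r).
    - now apply (weierstrass_double_zero_solution A rho). }
  generalize (filter_and _ _ Heq (weierstrass_neq_const Hrho HP 6)).
  apply filter_imp. intros z [-> Hz]. field. exact Hz.
Qed.

Lemma square_mul_weierstrass (z : C) :
  0 < Cmod z < Rmin r rho -> w z ^ 2 * (6 - P z) = 2 * A.
Proof.
  intros Hz. destruct (weierstrass_pole_cleared HP 6) as (B & HB & _ & HBP).
  assert (Hmin := Rmin_l r rho). assert (Hmin' := Rmin_r r rho).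
  assert (HF : w z ^ 2 * B z - 2 * A * z ^ 2 = 0).
  { apply (identity_theorem_disc (fun y => w y ^ 2 * B y - 2 * A * y ^ 2) (Rmin r rho)); [| |lra].
    - intros y Hy. destruct (Hw y) as [Hdw _]; [lra|].
      apply Cderivable_minus; apply Cderivable_mult.
      + eexists. apply (Cderiv_comp (fun x => x ^ 2) w); [apply Cderiv_pow | exact Hdw].
      + apply HB. lra.
      + apply Cderivable_const.
      + eexists. apply Cderiv_pow.
    - apply nhds_of_punctured; [rewrite Hw0; ring|].
      assert (Hdisc : nhds' 0 (fun y => 0 < Cmod y < rho)) by (apply nhds'_0_iff; now exists rho).
      generalize (filter_and _ _ square_mul_weierstrass_near_0 Hdisc).
      apply filter_imp. intros y [Hy Hyr]. rewrite <- HBP, <- Hy by exact Hyr. ring. }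
  rewrite <- HBP in HF by lra.
  assert (Hz0 : z <> 0) by (apply Cmod_gt_0; lra).
  replace (w z ^ 2 * (6 - P z))
    with ((w z ^ 2 * (z ^ 2 * (6 - P z)) - 2 * A * z ^ 2) / z ^ 2 + 2 * A) by (field; exact Hz0).
  rewrite HF. field. exact Hz0.
Qed.

End SquareAndWeierstrass.

Theorem theorem6 (kappa : R) (hk : (0 < kappa < 1)%R)
  (w dw : C -> C) (r : R) (hr : (0 < r)%R)
  (hw : forall z, Cmod z < r ->
          Cderiv w z (dw z) /\
          dw z * dw z = T6 (w z) - RtoC (1 - 2 * kappa ^ 2))
  (hw0 : w (RtoC 0) = RtoC 0)
  (P dP : C -> C) (rho : R) (hrho : (0 < rho)%R)
  (hP : weierstrass_local (RtoC (48 * (1 + 8 * kappa ^ 2)))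
                          (RtoC (64 * (1 - 20 * kappa ^ 2 - 8 * kappa ^ 4)))
                          rho P dP) :
  let lambda := sqrt (1 - kappa ^ 2) in
  forall z, 0 < Cmod z < Rmin r rho ->
    (RtoC 1 + (RtoC 2 * w z * w z - RtoC 1)) * (RtoC 6 - P z)
      = RtoC (4 * lambda ^ 2).
Proof.
  intros lambda z Hz.
  assert (Hlambda : (0 < 1 - kappa ^ 2)%R) by nra.
  assert (Elambda : (lambda ^ 2 = 1 - kappa ^ 2)%R) by (apply pow2_sqrt; lra).
  assert (H : w z ^ 2 * (6 - P z) = 2 * RtoC (lambda ^ 2)).
  { apply (square_mul_weierstrass (RtoC (lambda ^ 2)) w dw r P dP rho); try assumption.
    - rewrite Elambda. apply RtoC_neq. lra.
    - intros y Hy. destruct (hw y Hy) as [Hdw ->]. split; [exact Hdw|].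
      rewrite Elambda, !RtoC_minus, !RtoC_mult. ring.
    - rewrite Elambda.
      replace (48 * (9 - 8 * RtoC (1 - kappa ^ 2))) with (RtoC (48 * (1 + 8 * kappa ^ 2)))
        by (rewrite <- !RtoC_mult, <- !RtoC_minus, <- RtoC_mult; f_equal; ring).
      replace (64 * (36 * RtoC (1 - kappa ^ 2) - 27 - 8 * RtoC (1 - kappa ^ 2) ^ 2))
        with (RtoC (64 * (1 - 20 * kappa ^ 2 - 8 * kappa ^ 4)))
        by (rewrite <- RtoC_pow, <- !RtoC_mult, <- !RtoC_minus, <- RtoC_mult; f_equal; ring).
      exact hP. }
  rewrite RtoC_mult.
  replace ((1 + (2 * w z * w z - 1)) * (6 - P z)) with (2 * (w z ^ 2 * (6 - P z))) by ring.
  rewrite H. ring.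
Qed.
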